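(* Let $G$ be a locally compact group with a compact open subgroup and let $H$ be a closed subgroup of $G$. Assume that we have a local right action of $G$ on a locally compact space $X$ and that the restriction of the action to $H$ is locally homeomorphic. Then any function $f\in C_c(X)$ that is polynomial for the action of $H$ is also polynomial for the action of the larger group $G$.
   Context: Locally compact groups and spaces are Hausdorff. $e$ is the identity of $G$; a neighborhood of $e$ always means an open neighborhood. $C_c(X)$ is the space of continuous complex functions on $X$ with compact support; the support is the closure of the set where the function is non-zero. Local right action of a locally compact group $G$ on $X$: a continuous map $(x,p)\mapsto x\cdot p$ from an open subset $\Gamma\subseteq X\times G$ to $X$ such that (i) $(x,e)\in\Gamma$ and $x\cdot e=x$ for all $x\in X$; (ii) for $(x,p)\in\Gamma$ and $q\in G$: $(x,pq)\in\Gamma$ if and only if $(x\cdot p,q)\in\Gamma$, and in that case $x\cdot(pq)=(x\cdot p)\cdot q$. Restriction to a closed subgroup $H$: the local right action $(x,h)\mapsto x\cdot h$ of $H$ on $X$ defined on $\Gamma_H=\{(x,h)\in X\times H\mid (x,h)\in\Gamma\}$. A local right action is locally homeomorphic if for every $x\in X$ there is a neighborhood $V_x$ of the identity in the acting group such that $(x,p)\in\Gamma$ for all $p\in V_x$, the set $x\cdot V_x=\{x\cdot p\mid p\in V_x\}$ is open in $X$, and $p\mapsto x\cdot p$ is a homeomorphism from $V_x$ onto $x\cdot V_x$. For a local right action, $f\in C_c(X)$ and $p$ in the acting group, define $(p\cdot f)(x)=f(x\cdot p)$ if $(x,p)\in\Gamma$ and $(p\cdot f)(x)=0$ otherwise.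 Let $V_f$ be the set of $p$ in the acting group with $(x,p^{-1})\in\Gamma$ for all $x$ in the support of $f$; it is an open neighborhood of the identity, and $p\cdot f\in C_c(X)$ for $p\in V_f$. The function $f$ is polynomial for the action if there are a neighborhood $V\subseteq V_f$ of the identity in the acting group and a finite-dimensional subspace $F$ of $C_c(X)$ with $v\cdot f\in F$ for all $v\in V$. *)

(* Defs.v *)
From HB Require Import structures.
From mathcomp Require Import all_boot all_order all_algebra.
From mathcomp Require Import complex.
From mathcomp Require Import all_classical all_reals all_analysis.

Set Implicit Arguments.
Unset Strict Implicit.
Unset Printing Implicit Defensive.

Import GRing.Theory Num.Theory.

Local Open Scope classical_set_scope.
Local Open Scope ring_scope.
Local Open Scope complex_scope.

HB.mixin Record isTopologicalGroup G & Topological G & Group G := {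
  mulg_continuous : continuous (fun x : G * G => (x.1 * x.2)%g) ;
  invg_continuous : continuous (fun x : G => x^-1%g)
}.

#[short(type="topologicalGroupType")]
HB.structure Definition TopologicalGroup :=
  {G of Topological G & Group G & isTopologicalGroup G}.

Record subgroup (G : groupType) := Subgroup {
  subgroup_set :> set G ;
  subgroup_closed : group_closed (mem subgroup_set)
}.

(* An alias of [set_type H], so that the group structure can be found from the
   proof of closure stored in [H]. The topology is the one [set_type H] gets
   from the library, i.e., the topology induced by that of [G]. *)
Definition subgroup_type (G : groupType) (H : subgroup G) : Type :=
  set_type H.

HB.instance Definition _ (G : groupType) (H : subgroup G) :=
  SubChoice.copy (subgroup_type H) (set_type H).
HB.instance Definition _ (G : groupType) (H : subgroup G) :=
  SubChoice_isSubGroup.Build G _ (subgroup_type H) (subgroup_closed H).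

Section subgroup_topology.
Variables (G : topologicalGroupType) (H : subgroup G).

HB.instance Definition _ :=
  Topological.copy (subgroup_type H) (set_type H).

Definition subgroup_val (h : subgroup_type H) : G := val h.

Lemma subgroup_val1 : subgroup_val 1%g = 1%g.
Proof. exact: val1. Qed.

Lemma subgroup_valM (g h : subgroup_type H) :
  subgroup_val (g * h)%g = (subgroup_val g * subgroup_val h)%g.
Proof. exact: valM. Qed.

Lemma subgroup_valV (h : subgroup_type H) :
  subgroup_val h^-1%g = (subgroup_val h)^-1%g.
Proof. by []. Qed.

Lemma subgroup_val_continuous : continuous subgroup_val.
Proof. exact: (@initial_continuous (set_type H) G set_val). Qed.

Let subgroup_val_init (T : topologicalType) (f : T -> subgroup_type H) :
  continuous (subgroup_val \o f) -> continuous f.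
Proof.
exact: (@continuous_comp_initial (set_type H) T G set_val f).
Qed.

Let subgroup_mulg_continuous :
  continuous (fun x : subgroup_type H * subgroup_type H => (x.1 * x.2)%g).
Proof.
apply: subgroup_val_init => x.
rewrite [_ \o _](_ : _ = (fun y : G * G => (y.1 * y.2)%g) \o
  (fun x : subgroup_type H * subgroup_type H =>
    (subgroup_val x.1, subgroup_val x.2))); last first.
  by apply/funext => y /=; rewrite subgroup_valM.
apply: continuous_comp; last exact: mulg_continuous.
apply: cvg_pair => /=.
- by apply: continuous_comp; [exact: cvg_fst|exact: subgroup_val_continuous].
- by apply: continuous_comp; [exact: cvg_snd|exact: subgroup_val_continuous].
Qed.

Let subgroup_invg_continuous :
  continuous (fun x : subgroup_type H => x^-1%g).
Proof.
apply: subgroup_val_init => x.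
rewrite [_ \o _](_ : _ = (fun y : G => y^-1%g) \o subgroup_val) //.
apply: continuous_comp; first exact: subgroup_val_continuous.
exact: invg_continuous.
Qed.

HB.instance Definition _ := isTopologicalGroup.Build (subgroup_type H)
  subgroup_mulg_continuous subgroup_invg_continuous.

End subgroup_topology.

(* The partial map [dom -> X] is represented by a total function [act] whose
   values outside [dom] are irrelevant. *)
Record local_right_action (G : topologicalGroupType) (X : topologicalType) :=
  LocalRightAction {
    dom : set (X * G) ;
    act : X -> G -> X ;
    dom_open : open dom ;
    act_continuous : {within dom, continuous (fun xp => act xp.1 xp.2)} ;
    dom1 : forall x, dom (x, 1%g) ;
    act1 : forall x, act x 1%g = x ;
    domM : forall x p q, dom (x, p) ->
      dom (x, (p * q)%g) <-> dom (act x p, q) ;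
    actM : forall x p q, dom (x, p) -> dom (x, (p * q)%g) ->
      act x (p * q)%g = act (act x p) q
  }.

Arguments dom_open {G X} a : rename.
Arguments act_continuous {G X} a : rename.
Arguments dom1 {G X} a x : rename.
Arguments act1 {G X} a x : rename.

Section restriction.
Variables (G : topologicalGroupType) (X : topologicalType).
Variables (a : local_right_action G X) (H : subgroup G).

Let incl (xh : X * subgroup_type H) : X * G := (xh.1, subgroup_val xh.2).
Let rdom : set (X * subgroup_type H) := [set xh | dom a (xh.1, subgroup_val xh.2)].
Let ract (x : X) (h : subgroup_type H) : X := act a x (subgroup_val h).

Let incl_continuous : continuous incl.
Proof.
move=> xh; apply: cvg_pair => /=; first exact: cvg_fst.
by apply: continuous_comp; [exact: cvg_snd|exact: subgroup_val_continuous].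
Qed.

Let rdom_open : open rdom.
Proof.
move/continuousP: incl_continuous => /(_ _ (dom_open a)); exact.
Qed.

Let ract_continuous : {within rdom, continuous (fun xh => ract xh.1 xh.2)}.
Proof.
rewrite continuous_open_subspace; last exact: rdom_open.
move=> xh /set_mem xhD.
have := act_continuous a; rewrite continuous_open_subspace; last exact: dom_open.
move=> /(_ (incl xh) (mem_set xhD)) ac.
exact: (@continuous_comp _ _ _ incl (fun xp => act a xp.1 xp.2)
  xh (@incl_continuous xh) ac).
Qed.

Let rdom1 x : rdom (x, 1%g).
Proof. by rewrite /rdom/= subgroup_val1; exact: dom1. Qed.

Let ract1 x : ract x 1%g = x.
Proof. by rewrite /ract subgroup_val1; exact: act1. Qed.

Let rdomM x p q : rdom (x, p) -> rdom (x, (p * q)%g) <-> rdom (ract x p, q).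
Proof. by rewrite /rdom/= subgroup_valM; exact: domM. Qed.

Let ractM x p q : rdom (x, p) -> rdom (x, (p * q)%g) ->
  ract x (p * q)%g = ract (ract x p) q.
Proof. by rewrite /rdom/= /ract subgroup_valM; exact: actM. Qed.

Definition restrict_action : local_right_action (subgroup_type H) X :=
  LocalRightAction rdom_open ract_continuous rdom1 ract1 rdomM ractM.

End restriction.

(* [f] is a homeomorphism from the subspace [A] of [S] onto the subspace
   [f @` A] of [T], with inverse (the restriction of) [g]. *)
Definition homeomorphism_on (S T : topologicalType) (A : set S) (f : S -> T) :=
  exists g : T -> S, [/\ {within A, continuous f},
    {within f @` A, continuous g} & forall x, A x -> g (f x) = x].

Definition locally_homeomorphic (G : topologicalGroupType)
    (X : topologicalType) (a : local_right_action G X) :=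
  forall x, exists V : set G,
    [/\ open V /\ V 1%g, forall p, V p -> dom a (x, p),
        open (act a x @` V) & homeomorphism_on V (act a x)].

Section polynomial.
Variables (R : realType) (X : topologicalType).

(* [R[i]^o] is the field of complex numbers over [R], with its usual topology
   and seen as a vector space over itself. *)
Implicit Types (f : X -> R[i]^o) (F : set (X -> R[i]^o)).

Definition supp f : set X := closure [set x | f x != 0].

Definition Cc : set (X -> R[i]^o) :=
  [set f | continuous f /\ compact (supp f)].

Definition finite_dimensional F :=
  exists (n : nat) (b : 'I_n -> X -> R[i]^o), (forall i, F (b i)) /\
    forall f, F f -> exists c : 'I_n -> R[i], f = \sum_(i < n) c i *: b i.

Variables (G : topologicalGroupType) (a : local_right_action G X).

Definition translate (p : G) f : X -> R[i]^o :=
  fun x => if `[< dom a (x, p) >] then f (act a x p) else 0.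

Definition V_ f : set G := [set p | forall x, supp f x -> dom a (x, p^-1%g)].

Definition polynomial_for f :=
  exists (V : set G) (F : set (X -> R[i]^o)),
    [/\ open V /\ V 1%g, V `<=` V_ f,
        F `<=` Cc /\ submod_closed (mem F), finite_dimensional F &
        forall v, V v -> F (translate v f)].

End polynomial.

(* Main.v *)
Require Import Defs.
From HB Require Import structures.
From mathcomp Require Import all_boot all_order all_algebra.
From mathcomp Require Import complex ring lra.
From mathcomp Require Import all_classical all_reals all_analysis.

Set Implicit Arguments.
Unset Strict Implicit.
Unset Printing Implicit Defensive.

Import Order.TTheory GRing.Theory Num.Theory.
Import numFieldNormedType.Exports.

Local Open Scope classical_set_scope.
Local Open Scope ring_scope.
Local Open Scope complex_scope.

(** Fix a point [x].  The action of [H] is a chart around [x], so for [g] close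
    to [1] the point [x.g] is also [x.h] for some [h] in [H]; then [g = s * h]
    with [s] in the stabilizer of [x] in [G].  Using a compact open subgroup of
    [G] one finds a compact open subgroup [K], depending on [x], in which this
    factorization holds for every element: [K = S * L], where [S] is the
    stabilizer of [x] in [K] and [L] is the intersection of [H] and [K]
    ([exists_transitive_subgroup]).  The function [phi] on [K] that sends [k]
    to [f (x.k)], and to [0] where [x.k] is undefined, is continuous and
    invariant under left translation by [S], and its right translates by the
    elements of [L] near [1] span a finite-dimensional space.

    The heart of the proof is that then all right translates of [phi] by
    elements of [K] span a finite-dimensional space
    ([transitive_subgroup_translates_determined]).  Let [E] be the space of the
    continuous left [S]-invariant functions that satisfy every linear relation
    which holds between the right translates of [phi] by elements of [L] near
    [1].  As [K = S * L], a function in [E] is known once its values at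
    finitely many points of [L] are known, so [E] is finite-dimensional.  It
    contains [phi]; it is not visibly stable under [K], but it is stable under
    convolution [T] by any central function [u], because [T] commutes with left
    and right translations.  When [u] lives close enough to [1], the operator
    [T] is injective on [E], and Cayley-Hamilton provides a polynomial [p] with
    [p(T) = 0] on [E] and [p(0) != 0].  Since [T] commutes with right
    translations, [p(T) = 0] also on the span [N] of the right translates of
    [E].  Hence every [psi] in [N] is [T chi] with [chi] bounded by a fixed
    multiple of the sup norm of [psi], and a convolution smooths: a function in
    [N] which vanishes on a fine enough finite net is at most half its own sup
    norm, so it is zero.  Thus [N] is finite-dimensional
    ([translates_determined]).  This is the compactness argument behind the
    Peter-Weyl theorem.

    The convolution needs an invariant mean on the continuous functions on [K].
    It comes from averaging: a suitable average of finitely many right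
    translates of a function has arbitrarily small oscillation, the same is
    true of left translates, and because the two kinds of averages commute they
    single out the same constant.

    Finally, finitely many charts cover the support of [f], so that for [g]
    near [1] the translate of [f] by [g] is determined, linearly, by its values
    at finitely many points of [X]
    ([translates_determined_near_identity]), and such translates span a
    finite-dimensional space.  All this is done for real functions; for [f] it
    is applied to the real and to the imaginary part. *)

(** * Finite spanning families of row vectors *)

(** The source of every finite-dimensionality statement below: [w] lists the
    values of an object at finitely many points, or its coordinates, and a
    linear relation between such rows is lifted to one between the objects.  A
    maximal row-free choice among the [w x] does the job. *)
Lemma exists_row_free_spanning (F : fieldType) (T : Type) (P : set T) (n : nat)
    (w : T -> 'rV[F]_n) :
  exists m (t : 'I_m -> T), [/\ forall i, P (t i),
    row_free (\matrix_(i < m) w (t i)) &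
    forall x, P x -> (w x <= \matrix_(i < m) w (t i))%MS].
Proof.
suff ind k m (t : 'I_m -> T) : (n - m <= k)%N -> (forall i, P (t i)) ->
    row_free (\matrix_(i < m) w (t i)) ->
    exists m (t : 'I_m -> T), [/\ forall i, P (t i),
      row_free (\matrix_(i < m) w (t i)) &
      forall x, P x -> (w x <= \matrix_(i < m) w (t i))%MS].
  apply: (ind n 0%N (fun i => False_rect T (notF (ltn_ord i)))) => //.
  - by rewrite subn0.
  - by case.
  - by rewrite -row_leq_rank.
elim: k m t => [|k IH] m t mk Pt rf.
  exists m, t; split=> // x _; apply: submx_full.
  rewrite -row_leq_rank in rf.
  rewrite -col_leq_rank (leq_trans _ rf)//.
  by rewrite leqn0 subn_eq0 in mk.
case: (pselect (forall x, P x -> (w x <= \matrix_(i < m) w (t i))%MS)).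
  by move=> h; exists m, t.
move=> /existsNP[x] /not_implyP[Px /negP nx].
(* Otherwise append a vector outside of the row space. *)
pose t' := fun i : 'I_m.+1 => if unlift ord_max i is Some j then t j else x.
apply: (IH m.+1 t').
- by move: mk; rewrite subnS; case: (n - m)%N.
- by move=> i; rewrite /t'; case: unliftP.
apply/inj_row_free => v.
have -> : v *m (\matrix_i w (t' i)) =
    (\row_i v 0 (lift ord_max i)) *m (\matrix_i w (t i)) + v 0 ord_max *: w x.
  rewrite !mulmx_sum_row big_ord_recr /=; congr (_ + _).
    apply: eq_bigr => i _; rewrite !mxE !rowK /t'.
    have -> : widen_ord (leqnSn m) i = lift ord_max i.
      by apply/val_inj => /=; rewrite /bump leqNgt ltn_ord.
    by rewrite liftK.
  by rewrite rowK /t' unlift_none.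
move=> v0.
have vmax : v 0 ord_max = 0.
  apply/eqP/negPn/negP => vn0; apply: (negP nx).
  have -> : w x = (- (v 0 ord_max)^-1) *:
      ((\row_i v 0 (lift ord_max i)) *m (\matrix_i w (t i))).
    move/eqP: v0; rewrite addr_eq0 => /eqP ->.
    by rewrite scalerN scaleNr opprK scalerA mulVf// scale1r.
  by rewrite scalemx_sub// submxMl.
move: v0; rewrite vmax scale0r addr0 => /eqP.
rewrite mulmx_free_eq0// => /eqP v0.
apply/rowP => i; rewrite mxE; case: (unliftP ord_max i) => [j|] ->//.
by move/rowP: v0 => /(_ j); rewrite !mxE.
Qed.

Lemma submx_sum_rows (F : fieldType) (m n : nat) (t : 'I_m -> 'rV[F]_n)
    (w : 'rV[F]_n) :
  (w <= \matrix_(i < m) t i)%MS -> exists c : 'I_m -> F,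
    w = \sum_(i < m) c i *: t i.
Proof.
move=> /submxP[D ->]; exists (D 0).
by rewrite mulmx_sum_row; apply: eq_bigr => i _; rewrite rowK.
Qed.

(** * Topological groups and compactness *)

(** Compactness, as uniformity of what holds locally along any filter, is applied
    to the filter of the finite sequences ordered by inclusion. *)
Lemma compact_finite_net (T : topologicalType) (A : set T) (U : T -> set T) :
  compact A -> (forall x, A x -> nbhs x (U x)) ->
  exists s : seq T, (forall z, z \in s -> A z) /\
    forall x, A x -> exists2 z, z \in s & U z x.
Proof.
move=> /compact_near_coveringP cA AU.
pose F := filter_from [set: seq T] (fun s => [set s' : seq T | {subset s <= s'}]).
have FF : Filter F.
  apply: filter_from_filter; first by exists [::].
  move=> s s' _ _; exists (s ++ s') => // t st; split=> z zs; apply: st.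
  - by rewrite mem_cat zs.
  - by rewrite mem_cat zs orbT.
have [x Ax|s _ cov] :=
    cA _ F (fun (s : seq T) x => exists2 z, z \in s & A z /\ U z x) FF.
  exists (U x, [set s : seq T | x \in s]); last first.
    by move=> [x' s] [/= Ux' xs]; exists x.
  split; first exact: AU.
  by exists [:: x] => // s /(_ x); apply; rewrite mem_head.
exists [seq z <- s | `[< A z >]]; split=> [z|x Ax].
  by rewrite mem_filter => /andP[/asboolP].
have [z zs [Az Uzx]] := cov s (fun z zs => zs) x Ax.
by exists z => //; rewrite mem_filter zs andbT; apply/asboolP.
Qed.

Lemma cvg_mulg (G : topologicalGroupType) (T : Type) (F : set_system T)
    (FF : Filter F) (u v : T -> G) (a b : G) :
  u @ F --> a -> v @ F --> b -> (fun t => u t * v t)%g @ F --> (a * b)%g.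
Proof.
move=> ua vb; apply: (cvg_comp (fun t => (u t, v t)) (fun x => x.1 * x.2)%g).
  exact: cvg_pair ua vb.
exact: (@mulg_continuous G (a, b)).
Qed.

Lemma cvg_invg (G : topologicalGroupType) (T : Type) (F : set_system T)
    (FF : Filter F) (u : T -> G) (a : G) :
  u @ F --> a -> (fun t => (u t)^-1%g) @ F --> (a^-1)%g.
Proof. by move=> ua; apply: cvg_comp ua _; exact: (@invg_continuous G a). Qed.

Lemma mulgl_continuous (G : topologicalGroupType) (g : G) :
  continuous (fun x => g * x)%g.
Proof. by move=> x; apply: cvg_mulg; [exact: cvg_cst|exact: cvg_id]. Qed.

Lemma mulgr_continuous (G : topologicalGroupType) (g : G) :
  continuous (fun x => x * g)%g.
Proof. by move=> x; apply: cvg_mulg; [exact: cvg_id|exact: cvg_cst]. Qed.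

Lemma nbhs_mulgl (G : topologicalGroupType) (g : G) (U : set G) :
  nbhs 1%g U -> nbhs g [set x | U (g^-1 * x)%g].
Proof.
by move=> U1; apply: (@mulgl_continuous G g^-1%g g); rewrite mulVg.
Qed.

Lemma nbhs_mulgr (G : topologicalGroupType) (g : G) (U : set G) :
  nbhs 1%g U -> nbhs g [set x | U (x * g^-1)%g].
Proof.
by move=> U1; apply: (@mulgr_continuous G g^-1%g g); rewrite mulgV.
Qed.

Lemma near_invg (G : topologicalGroupType) (P : set G) :
  (\forall u \near 1%g, P u) -> \forall u \near 1%g, P u^-1%g.
Proof.
have : (fun x : G => x^-1%g) @ 1%g --> (1^-1 : G)%g by exact: invg_continuous.
by rewrite invg1; exact.
Qed.

Lemma near_mulVg (G : topologicalGroupType) (g : G) (P : set G) :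
  (\forall u \near 1%g, P u) -> \forall h \near g, P (h^-1 * g)%g.
Proof.
have : (fun h : G => h^-1 * g)%g @ g --> (g^-1 * g)%g.
  by apply: cvg_mulg; [apply: cvg_invg; exact: cvg_id|exact: cvg_cst].
by rewrite mulVg; exact.
Qed.

(** Uniformity in both translations at once: the product of two copies of [K] is
    compact, so the continuity at the points [((g, g'), 1)] is uniform. *)
Lemma compact_group_unif_continuous (R : realType) (K : topologicalGroupType)
    (f : K -> R) (e : R) : compact [set: K] -> continuous f -> 0 < e ->
  \forall u \near 1%g, forall g g' : K, `|f (g * u * g')%g - f (g * g')%g| < e.
Proof.
move=> cK cf e0.
have cKK : compact [set: K * K].
  by rewrite -setXTT; exact: compact_setX.
suff: \forall u \near 1%g, [set: K * K] `<=`
    (fun z => `|f (z.1 * u * z.2)%g - f (z.1 * z.2)%g| < e).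
  by apply: filterS => u Pu g g'; exact: (Pu (g, g') I).
apply: (iffLR (compact_near_coveringP _) cKK) => -[g g'] _.
have : (fun t : (K * K) * K => f (t.1.1 * t.2 * t.1.2)%g - f (t.1.1 * t.1.2)%g)
    @ ((g, g'), 1%g) --> (f (g * 1 * g')%g - f (g * g')%g : R).
  have c1 : (fun t : (K * K) * K => t.1) @ ((g, g'), 1%g) --> (g, g').
    exact: cvg_fst.
  have c11 : (fun t : (K * K) * K => t.1.1) @ ((g, g'), 1%g) --> g.
    by apply: (cvg_comp (fun t : (K * K) * K => t.1) fst) c1 _; exact: cvg_fst.
  have c12 : (fun t : (K * K) * K => t.1.2) @ ((g, g'), 1%g) --> g'.
    by apply: (cvg_comp (fun t : (K * K) * K => t.1) snd) c1 _; exact: cvg_snd.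
  apply: cvgB.
    apply: continuous_cvg; first exact: cf.
    by apply: cvg_mulg => //; apply: cvg_mulg => //; exact: cvg_snd.
  by apply: continuous_cvg; [exact: cf|exact: cvg_mulg].
rewrite mulg1 subrr => /cvgr0Pnorm_lt/(_ e e0); exact.
Qed.

Lemma continuous_translr (G : topologicalGroupType) (T : topologicalType)
    (f : G -> T) (a : G) : continuous f -> continuous (fun x => f (x * a)%g).
Proof.
move=> cf x; apply: (@continuous_comp _ _ _ (fun x => x * a)%g f).
  exact: mulgr_continuous.
exact: cf.
Qed.

(** * Averages of translates *)

Section averages.
Variables (R : realType) (K : groupType).
Implicit Types (s t : seq K) (f : K -> R).

Definition right_avg s f : K -> R :=
  fun g => (size s)%:R^-1 * \sum_(x <- s) f (g * x)%g.

Definition left_avg s f : K -> R :=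
  fun g => (size s)%:R^-1 * \sum_(x <- s) f (x * g)%g.

Lemma left_avgE s f g : left_avg s f g =
  right_avg [seq x^-1%g | x <- s] (fun x => f x^-1%g) g^-1%g.
Proof.
rewrite /left_avg /right_avg size_map big_map; congr (_ * _); apply: eq_bigr => x _ /=.
by rewrite -invgM invgK.
Qed.

Lemma le_right_avg s f g b : (0 < size s)%N -> (forall x, f x <= b) -> right_avg s f g <= b.
Proof.
move=> s0 fb; rewrite /right_avg ler_pdivrMl ?ltr0n//.
apply: (@le_trans _ _ (\sum_(x <- s) b)); first exact: ler_sum.
by rewrite big_const_seq count_predT iter_addr_0 mulr_natl.
Qed.

Lemma right_avgN s f g : right_avg s (fun x => - f x) g = - right_avg s f g.
Proof. by rewrite /right_avg sumrN mulrN. Qed.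

Lemma right_avgD s f h g :
  right_avg s (fun x => f x + h x) g = right_avg s f g + right_avg s h g.
Proof. by rewrite /right_avg big_split mulrDr. Qed.

Lemma right_avgZ s a f g : right_avg s (fun x => a * f x) g = a * right_avg s f g.
Proof. by rewrite /right_avg -mulr_sumr mulrCA. Qed.

Lemma right_avg_cst s a g : (0 < size s)%N -> right_avg s (fun=> a) g = a.
Proof.
move=> s0; rewrite /right_avg big_const_seq count_predT iter_addr_0 -[a *+ _]mulr_natl.
by rewrite mulKf// pnatr_eq0 -lt0n.
Qed.

Lemma ge_right_avg s f g b : (0 < size s)%N -> (forall x, b <= f x) -> b <= right_avg s f g.
Proof.
move=> s0 fb; rewrite -lerN2 -right_avgN; apply: le_right_avg => // x.
by rewrite lerN2.
Qed.

Lemma right_avg_near s f g c e : (0 < size s)%N -> (forall x, `|f x - c| <= e) ->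
  `|right_avg s f g - c| <= e.
Proof.
move=> s0 fc; have : forall x, c - e <= f x <= c + e.
  by move=> x; rewrite -ler_distl.
by rewrite ler_distl => h; rewrite le_right_avg ?ge_right_avg// => x; have /andP[] := h x.
Qed.

Lemma left_avg_near s f g c e : (0 < size s)%N -> (forall x, `|f x - c| <= e) ->
  `|left_avg s f g - c| <= e.
Proof.
move=> s0 fc; rewrite left_avgE.
by apply: right_avg_near => [|x]; rewrite ?size_map.
Qed.

Lemma left_avgD s f h g : left_avg s (fun x => f x + h x) g = left_avg s f g + left_avg s h g.
Proof. by rewrite !left_avgE -right_avgD. Qed.

Lemma left_avgZ s a f g : left_avg s (fun x => a * f x) g = a * left_avg s f g.
Proof. by rewrite !left_avgE -right_avgZ. Qed.

(** Averages compose, so a property reached in several averaging steps is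
    reached in one. *)
Lemma right_avg_right_avg s t f g :
  right_avg s (right_avg t f) g = right_avg [seq (x * y)%g | x <- s, y <- t] f g.
Proof.
rewrite /right_avg size_allpairs big_allpairs_dep natrM invfM -mulrA; congr (_ * _).
rewrite -mulr_sumr; congr (_ * _); apply: eq_bigr => x _; apply: eq_bigr => y _.
by rewrite mulgA.
Qed.

Lemma left_avg_left_avg s t f g :
  left_avg s (left_avg t f) g = left_avg [seq (y * x)%g | x <- s, y <- t] f g.
Proof.
rewrite /left_avg size_allpairs big_allpairs_dep natrM invfM -mulrA; congr (_ * _).
rewrite -mulr_sumr; congr (_ * _); apply: eq_bigr => x _; apply: eq_bigr => y _.
by rewrite mulgA.
Qed.

(** Left and right translations commute.  This is what makes the mean unique and
    additive. *)
Lemma right_avg_left_avg s t f g : right_avg s (left_avg t f) g = left_avg t (right_avg s f) g.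
Proof.
rewrite /right_avg /left_avg -!mulr_sumr mulrCA; congr (_ * (_ * _)).
by rewrite exchange_big; apply: eq_bigr => x _; apply: eq_bigr => y _; rewrite mulgA.
Qed.

End averages.

Lemma ler_sum_drop (R : realType) (T : eqType) (s : seq T) (F : T -> R) a b x :
  x \in s -> F x <= a -> (forall y, F y <= b) ->
  \sum_(y <- s) F y <= (size s)%:R * b - (b - a).
Proof.
move=> xs Fa Fb; rewrite (big_rem x)//=.
have : \sum_(y <- rem x s) F y <= (size s).-1%:R * b.
  rewrite -(size_rem xs) mulr_natl -iter_addr_0 -count_predT -big_const_seq.
  exact: ler_sum.
have -> : size s = (size s).-1.+1 by case: s xs.
by rewrite -(natr1 (size s).-1) /=; lra.
Qed.

Section mean.
Variables (R : realType) (K : topologicalGroupType).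
Hypothesis cK : compact [set: K].
Implicit Types (s t : seq K) (f h : K -> R).

Lemma compact_group_net (U : set K) : nbhs 1%g U ->
  exists2 s : seq K, (0 < size s)%N &
    forall g, exists2 z, z \in s & U (g * z^-1)%g.
Proof.
move=> U1.
have [s [_ cov]] := compact_finite_net cK (fun z _ => @nbhs_mulgr K z U U1).
exists s => [|g]; last exact: cov.
by have [z zs _] := cov 1%g I; case: s zs {cov}.
Qed.

Lemma compact_group_bounded f : continuous f ->
  exists2 M : R, 0 <= M & forall g, `|f g| <= M.
Proof.
move=> cf; have U1 := compact_group_unif_continuous cK cf (@ltr01 R).
have [s _ cov] := compact_group_net U1.
exists (\sum_(z <- s) `|f z| + 1).
  by rewrite addr_ge0// sumr_ge0.
move=> g; have [z zs /(_ 1%g z)] := cov g.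
rewrite !mul1g mulgVK => /ltW gz.
rewrite (big_rem z)//= -addrA addrC -addrA.
have : 0 <= \sum_(y <- rem z s) `|f y| by rewrite sumr_ge0.
have := ler_normD (f g - f z) (f z); rewrite subrK; lra.
Qed.

(** Let the values of an average of [f] lie in an interval of length [D].  If
    all of them are in the upper half, the interval can be halved.  Otherwise the
    average is small at some [c], hence also near [c]; with finitely many
    translates, in a number [n] that depends on [f] and [e] only, every point is
    carried near [c] by one of them, and the new average gains about [D / (2 * n)]
    on the upper end.  The modulus of continuity is the one of [f] all along, so
    the excess of [D] over [e / 2] shrinks by a fixed factor [q < 1] at each
    step. *)
Lemma right_avg_small_oscillation f (e : R) : continuous f -> 0 < e ->
  exists s m, (0 < size s)%N /\ forall g, m <= right_avg s f g <= m + e.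
Proof.
move=> cf e0; have [M M0 fM] := compact_group_bounded cf.
(* A quarter of [e] is lost to the modulus of continuity; the half kept in the
   invariant [main] absorbs it. *)
have e40 : 0 < e / 4 by rewrite divr_gt0.
have [z z0 cov] := compact_group_net (compact_group_unif_continuous cK cf e40).
set n := size z in z0; pose q : R := 1 - (2 * n%:R)^-1.
have n1 : 1 <= n%:R :> R by rewrite ler1n.
have n0 : 0 < n%:R :> R by rewrite ltr0n.
have q12 : 1 / 2 <= q < 1.
  rewrite /q invfM; have : 0 < (n%:R^-1 : R) <= 1 by rewrite invr_gt0 n0 invf_le1.
  lra.
have main k : exists s m, (0 < size s)%N /\
    forall g, m <= right_avg s f g <= m + (e / 2 + q ^+ k * (2 * M)).
  elim: k => [|k [s [m [s0 IH]]]].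
    exists [:: 1%g], (- M); split=> // g.
    rewrite /right_avg big_seq1 invr1 mul1r mulg1 expr0.
    by have := fM g; rewrite ler_norml; lra.
  set D := e / 2 + q ^+ k * (2 * M) in IH.
  have qk0 : 0 <= q ^+ k * (2 * M) by rewrite mulr_ge0 ?exprn_ge0//; lra.
  have [[c cD]|noc] := pselect (exists c, right_avg s f c <= m + D / 2).
    (* [g * y^-1] is near [1] for some [y] in the net [z], and then
       [g * (y^-1 * c)] is near [c]. *)
    exists [seq (x * y)%g | x <- [seq (y^-1 * c)%g | y <- z], y <- s], m.
    split; first by rewrite size_allpairs size_map muln_gt0 z0.
    move=> g; rewrite -right_avg_right_avg; apply/andP; split.
      by apply: ge_right_avg => [|x]; [rewrite size_map|have /andP[] := IH x].
    rewrite {1}/right_avg size_map big_map -/n ler_pdivrMl//.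
    have [y yz gy] := cov g.
    apply: le_trans (@ler_sum_drop R K z (fun y => right_avg s f (g * (y^-1 * c))%g)
      (m + D / 2 + e / 4) (m + D) y yz _ _) _; last first.
    - rewrite -/n.
      have -> : n%:R * (m + (e / 2 + q ^+ k.+1 * (2 * M))) =
          n%:R * (m + D) - q ^+ k * M.
        by rewrite exprS /D /q; field; rewrite pnatr_eq0 -lt0n.
      by rewrite /D; lra.
    - by move=> x; have /andP[] := IH (g * (x^-1 * c))%g.
    - suff: `|right_avg s f (g * (y^-1 * c))%g - right_avg s f c| <= e / 4.
        by rewrite ler_distl; lra.
      have -> : right_avg s f (g * (y^-1 * c))%g - right_avg s f c =
          right_avg s (fun x => f (g * y^-1 * x)%g - f x) c.
        rewrite /right_avg -mulrBr -sumrB; congr (_ * _).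
        by apply: eq_bigr => x _; rewrite !mulgA.
      rewrite -[right_avg _ _ _]subr0; apply: right_avg_near => // x; rewrite subr0.
      by have := gy 1%g x; rewrite !mul1g => /ltW.
  exists s, (m + D / 2); split=> // g.
  have -> /= : m + D / 2 <= right_avg s f g.
    by rewrite leNgt; apply/negP => /ltW sg; apply: noc; exists g.
  have /andP[_] := IH g.
  have : q ^+ k * (2 * M) / 2 <= q ^+ k.+1 * (2 * M).
    by rewrite exprS -[leRHS]mulrA [leRHS]mulrC; apply: ler_wpM2l => //; lra.
  rewrite /D; lra.
have [k qk] : exists k, q ^+ k * (2 * M) <= e / 2.
  have : (fun k => q ^+ k * (2 * M)) @ \oo --> (0 * (2 * M) : R).
    apply: cvgMl; apply: cvg_expr; rewrite ger0_norm; lra.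
  rewrite mul0r => /cvgr0Pnorm_le/(_ (e / 2)).
  rewrite divr_gt0// => /(_ isT)[k _ /(_ k (leqnn k))] qk; exists k.
  exact: le_trans (ler_norm _) qk.
have [s [m [s0 sm]]] := main k; exists s, m; split=> // g.
have := sm g; lra.
Qed.
End mean.

(** * The invariant mean of a compact group *)

Lemma continuous_sum (R : realType) (T : topologicalType) (I : Type)
    (r : seq I) (F : I -> T -> R) : (forall i, continuous (F i)) ->
  continuous (fun x => \sum_(i <- r) F i x).
Proof.
move=> cF; elim: r => [|i r IH].
  by under eq_fun do rewrite big_nil; exact: cst_continuous.
under eq_fun do rewrite big_cons.
by move=> x; apply: cvgD; [exact: cF|exact: IH].
Qed.

Section mean_value.
Variables (R : realType) (K : topologicalGroupType).
Hypothesis cK : compact [set: K].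
Implicit Types (s t : seq K) (f h : K -> R).

Lemma left_avg_small_oscillation f (e : R) : continuous f -> 0 < e ->
  exists t m, (0 < size t)%N /\ forall g, m <= left_avg t f g <= m + e.
Proof.
move=> cf e0; have cfV : continuous (fun x => f x^-1%g).
  by move=> x; apply: continuous_comp; [exact: invg_continuous|exact: cf].
have [s [m [s0 sm]]] := right_avg_small_oscillation cK cfV e0.
exists [seq x^-1%g | x <- s], m; rewrite size_map; split=> // g.
by rewrite left_avgE mapK//; exact: invgK.
Qed.

Lemma right_avg_le_left_avg s t f a b : (0 < size s)%N -> (0 < size t)%N ->
  (forall g, a <= right_avg s f g) -> (forall g, left_avg t f g <= b) -> a <= b.
Proof.
move=> s0 t0 sa tb; apply: (@le_trans _ _ (right_avg s (left_avg t f) 1%g)).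
  by rewrite right_avg_left_avg left_avgE ge_right_avg// size_map.
exact: le_right_avg.
Qed.

Lemma left_avg_le_right_avg s t f a b : (0 < size s)%N -> (0 < size t)%N ->
  (forall g, a <= left_avg t f g) -> (forall g, right_avg s f g <= b) -> a <= b.
Proof.
move=> s0 t0 sa tb; apply: (@le_trans _ _ (right_avg s (left_avg t f) 1%g)).
  exact: ge_right_avg.
by rewrite right_avg_left_avg left_avgE le_right_avg// size_map.
Qed.

(** On a compact group this is the integral of a continuous [f] against the
    normalized Haar measure. *)
Definition mean f : R :=
  sup [set m | exists2 s, (0 < size s)%N & forall g, m <= right_avg s f g].

Lemma mean_ge f s m : continuous f -> (0 < size s)%N ->
  (forall g, m <= right_avg s f g) -> m <= mean f.
Proof.
move=> cf s0 sm; apply: ub_le_sup; last by exists s.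
have [t [b [t0 tb]]] := left_avg_small_oscillation cf ltr01.
exists (b + 1) => x [s' s'0 s'x]; apply: (right_avg_le_left_avg s'0 t0 s'x) => g.
by have /andP[] := tb g.
Qed.

Lemma mean_le f t b : continuous f -> (0 < size t)%N ->
  (forall g, left_avg t f g <= b) -> mean f <= b.
Proof.
move=> cf t0 tb; apply: ge_sup.
  have [s [m [s0 sm]]] := right_avg_small_oscillation cK cf ltr01.
  by exists m, s => // g; have /andP[] := sm g.
by move=> m [s s0 sm]; exact: (right_avg_le_left_avg s0 t0 sm).
Qed.

Lemma mean_approx f (e : R) : continuous f -> 0 < e ->
  (exists2 s, (0 < size s)%N & forall g, `|right_avg s f g - mean f| <= e) /\
  (exists2 t, (0 < size t)%N & forall g, `|left_avg t f g - mean f| <= e).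
Proof.
move=> cf e0; have e20 : 0 < e / 2 by rewrite divr_gt0.
have [s [m [s0 sm]]] := right_avg_small_oscillation cK cf e20.
have [t [b [t0 tb]]] := left_avg_small_oscillation cf e20.
have mle : m <= mean f.
  by apply: mean_ge s0 _ => // g; have /andP[] := sm g.
have bge : mean f <= b + e / 2.
  by apply: mean_le t0 _ => // g; have /andP[] := tb g.
have bm : b <= m + e / 2.
  by apply: (left_avg_le_right_avg s0 t0 (f := f)) => g;
    [have /andP[] := tb g|have /andP[] := sm g].
split; [exists s|exists t] => // g; rewrite ler_distl.
  by have := sm g; lra.
by have := tb g; lra.
Qed.

(** A constant approximated by left averages and a constant approximated by right
    averages are equal, because these averages commute. *)
Lemma mean_left_avg_unique f (c : R) : continuous f ->
  (forall e, 0 < e ->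
    exists2 t, (0 < size t)%N & forall g, `|left_avg t f g - c| <= e) ->
  mean f = c.
Proof.
move=> cf fc; apply/eqP; rewrite -subr_eq0 -normr_le0; apply/ler_addgt0Pr => e e0.
have e20 : 0 < e / 2 by rewrite divr_gt0.
have [[s s0 sf] _] := mean_approx cf e20; have [t t0 tf] := fc _ e20.
have h1 : mean f - e / 2 <= c + e / 2.
  by apply: (right_avg_le_left_avg s0 t0 (f := f)) => g;
    [have := sf g|have := tf g]; rewrite ler_distl => /andP[].
have h2 : c - e / 2 <= mean f + e / 2.
  by apply: (left_avg_le_right_avg s0 t0 (f := f)) => g;
    [have := tf g|have := sf g]; rewrite ler_distl => /andP[].
by rewrite add0r ler_norml; lra.
Qed.

Lemma mean_right_avg_unique f (c : R) : continuous f ->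
  (forall e, 0 < e ->
    exists2 s, (0 < size s)%N & forall g, `|right_avg s f g - c| <= e) ->
  mean f = c.
Proof.
move=> cf fc; apply/eqP; rewrite -subr_eq0 -normr_le0; apply/ler_addgt0Pr => e e0.
have e20 : 0 < e / 2 by rewrite divr_gt0.
have [_ [t t0 tf]] := mean_approx cf e20; have [s s0 sf] := fc _ e20.
have h1 : c - e / 2 <= mean f + e / 2.
  by apply: (right_avg_le_left_avg s0 t0 (f := f)) => g;
    [have := sf g|have := tf g]; rewrite ler_distl => /andP[].
have h2 : mean f - e / 2 <= c + e / 2.
  by apply: (left_avg_le_right_avg s0 t0 (f := f)) => g;
    [have := tf g|have := sf g]; rewrite ler_distl => /andP[].
by rewrite add0r ler_norml; lra.
Qed.

Lemma left_avg_continuous t f : continuous f -> continuous (left_avg t f).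
Proof.
move=> cf x; apply: cvgMr; apply: continuous_sum => y {}x.
by apply: continuous_comp; [exact: mulgl_continuous|exact: cf].
Qed.

Lemma mean_left_avg t f : continuous f -> (0 < size t)%N -> mean (left_avg t f) = mean f.
Proof.
move=> cf t0; apply: mean_right_avg_unique => [|e e0]; first exact: left_avg_continuous.
have [[s s0 sf] _] := mean_approx cf e0; exists s => // g.
by rewrite right_avg_left_avg; exact: left_avg_near.
Qed.

(** The averages that are good for [f] need not be good for [h].  Average first
    by [t] for [f]; the left average of [h] by [t] has the same mean as [h], so
    a second average [t'] brings it close to [mean h], and it keeps the first
    function close to [mean f]. *)
Lemma meanD f h : continuous f -> continuous h ->
  mean (fun x => f x + h x) = mean f + mean h.
Proof.
move=> cf ch; apply: mean_left_avg_unique => [x|e e0].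
  by apply: cvgD; [exact: cf|exact: ch].
have e20 : 0 < e / 2 by rewrite divr_gt0.
have [_ [t t0 tf]] := mean_approx cf e20.
have [_ [t' t'0 t'h]] := mean_approx (left_avg_continuous (t := t) ch) e20.
rewrite mean_left_avg// in t'h.
exists [seq (y * x)%g | x <- t', y <- t] => [|g].
  by rewrite size_allpairs muln_gt0 t0 t'0.
rewrite left_avgD -!left_avg_left_avg opprD addrACA (le_trans (ler_normD _ _))//.
have := t'h g; have := left_avg_near (c := mean f) g t'0 tf; lra.
Qed.

Lemma meanZ a f : continuous f -> mean (fun x => a * f x) = a * mean f.
Proof.
move=> cf; apply: mean_left_avg_unique => [x|e e0]; first by apply: cvgMr; exact: cf.
have ea0 : 0 < e / (`|a| + 1) by rewrite divr_gt0// ltr_wpDl.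
have [_ [t t0 tf]] := mean_approx cf ea0; exists t => // g.
rewrite left_avgZ -mulrBr normrM.
apply: (@le_trans _ _ ((`|a| + 1) * (e / (`|a| + 1)))).
  by apply: ler_pM => //; rewrite lerDl.
by rewrite mulrC divfK// gt_eqF// ltr_wpDl.
Qed.

Lemma mean_cst a : mean (fun=> a) = a.
Proof.
apply: mean_right_avg_unique => [|e e0]; first exact: cst_continuous.
by exists [:: 1%g] => // g; rewrite right_avg_cst// subrr normr0 ltW.
Qed.

Lemma mean_ge0 f : continuous f -> (forall x, 0 <= f x) -> 0 <= mean f.
Proof.
move=> cf f0; apply: (mean_ge (s := [:: 1%g])) => // g.
exact: ge_right_avg.
Qed.

Lemma mean_mono f h : continuous f -> continuous h -> (forall x, f x <= h x) ->
  mean f <= mean h.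
Proof.
move=> cf ch fh; have : 0 <= mean (fun x => h x + -1 * f x).
  apply: mean_ge0 => [x|x]; last by rewrite mulN1r subr_ge0.
  by apply: cvgD; [exact: ch|apply: cvgMr; exact: cf].
rewrite meanD ?meanZ ?mulN1r ?subr_ge0//.
by move=> x; apply: cvgMr; exact: cf.
Qed.

Lemma mean_norm_le f h : continuous f -> continuous h ->
  (forall x, `|f x| <= h x) -> `|mean f| <= mean h.
Proof.
move=> cf ch fh; rewrite ler_norml; apply/andP; split.
  rewrite -mulN1r -meanZ//; apply: mean_mono => // [x|x].
    by apply: cvgMr; exact: ch.
  by have := fh x; rewrite ler_norml mulN1r => /andP[].
by apply: mean_mono => // x; exact: le_trans (ler_norm _) (fh x).
Qed.

Lemma mean_mull a f : continuous f -> mean (fun x => f (a * x)%g) = mean f.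
Proof.
move=> cf; apply: mean_right_avg_unique => [x|e e0].
  by apply: continuous_comp; [exact: mulgl_continuous|exact: cf].
have [[s s0 sf] _] := mean_approx cf e0; exists s => // g.
have := sf (a * g)%g; congr (`|_ * _ - _| <= _).
by apply: eq_bigr => x _; rewrite mulgA.
Qed.

Lemma mean_mulr a f : continuous f -> mean (fun x => f (x * a)%g) = mean f.
Proof.
move=> cf; apply: mean_left_avg_unique => [x|e e0].
  by apply: continuous_comp; [exact: mulgr_continuous|exact: cf].
have [_ [t t0 tf]] := mean_approx cf e0; exists t => // g.
have := tf (g * a)%g; congr (`|_ * _ - _| <= _).
by apply: eq_bigr => x _; rewrite mulgA.
Qed.

(** Finitely many right translates of the set where [f] exceeds [f a / 2] cover
    the group, so the corresponding average of [f] is bounded below. *)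
Lemma mean_gt0 f a : continuous f -> (forall x, 0 <= f x) -> 0 < f a ->
  0 < mean f.
Proof.
move=> cf f0 fa; have fa20 : 0 < f a / 2 by rewrite divr_gt0.
have [z z0 cov] := compact_group_net cK
  (compact_group_unif_continuous cK cf fa20).
have n0 : 0 < (size z)%:R^-1 :> R by rewrite invr_gt0 ltr0n.
apply: (@lt_le_trans _ _ ((size z)%:R^-1 * (f a / 2))); first exact: mulr_gt0.
apply: (mean_ge (s := [seq (y^-1 * a)%g | y <- z])) => //.
  by rewrite size_map.
move=> g; rewrite /right_avg size_map big_map; apply: ler_wpM2l; first exact: ltW.
have [y yz /(_ 1%g a)] := cov g; rewrite !mul1g ltr_distl => /andP[ga _].
rewrite (big_rem y)//= mulgA -[leLHS]addr0; apply: lerD; first by lra.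
exact: sumr_ge0.
Qed.

End mean_value.

(** * Central functions concentrated near the identity *)

(** How a function is shown to vanish here: it suffices that every bound on its
    absolute value can be halved. *)
Lemma halving_eq0 (R : realType) (T : Type) (f : T -> R) (M : R) :
  (forall x, `|f x| <= M) ->
  (forall B, (forall x, `|f x| <= B) -> forall x, `|f x| <= B / 2) ->
  forall x, f x = 0.
Proof.
move=> fM half x; pose B := sup (range (fun y => `|f y|)).
have ubB y : `|f y| <= B.
  apply: ub_le_sup; last by exists y.
  by exists M => _ [z _ <-].
have : B <= B / 2.
  by apply: ge_sup => [|_ [z _ <-]]; [exists `|f x|, x|exact: half].
by move=> BB; apply/eqP; rewrite -normr_le0; have := ubB x; have := normr_ge0 (f x); lra.
Qed.

Section oscillation_length.
Variables (R : realType) (K : topologicalGroupType).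
Hypothesis cK : compact [set: K].
Variable f : K -> R.
Hypothesis cf : continuous f.

(** The sup distance between [f] and its translate by [k], uniformly over all
    two-sided translates of [f].  It is a length function on the group, and
    the two-sided translations make it central. *)
Definition osc (k : K) : R :=
  sup (range (fun z : K * K => `|f (z.1 * k * z.2)%g - f (z.1 * z.2)%g|)).

Lemma osc_ub k g g' : `|f (g * k * g')%g - f (g * g')%g| <= osc k.
Proof.
apply: ub_le_sup; last by exists (g, g').
have [M _ fM] := compact_group_bounded cK cf.
exists (M + M) => _ [z _ <-]; apply: le_trans (ler_normB _ _) _.
exact: lerD.
Qed.

Lemma osc_le k b : (forall g g', `|f (g * k * g')%g - f (g * g')%g| <= b) ->
  osc k <= b.
Proof.
move=> kb; apply: ge_sup => [|_ [z _ <-]]; last exact: kb.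
by eexists; exists (1%g, 1%g).
Qed.

Lemma osc_ge0 k : 0 <= osc k.
Proof. exact: le_trans (normr_ge0 _) (osc_ub k 1%g 1%g). Qed.

Lemma osc1 : osc 1%g = 0.
Proof.
apply/le_anti; rewrite osc_ge0 andbT; apply: osc_le => g g'.
by rewrite mulg1 subrr normr0.
Qed.

Lemma oscC k h : osc (k * h)%g = osc (h * k)%g.
Proof.
suff main x y : osc (x * y)%g <= osc (y * x)%g by apply/le_anti; rewrite !main.
apply: osc_le => g g'; have := osc_ub (y * x) (g * y^-1)%g (y * g')%g.
by rewrite !mulgA !mulgVK.
Qed.

Lemma oscM k h : osc (k * h)%g <= osc k + osc h.
Proof.
apply: osc_le => g g'; apply: le_trans (lerD (osc_ub k g (h * g')%g) (osc_ub h g g')).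
rewrite !mulgA; apply: le_trans (ler_normD _ _).
by rewrite addrA subrK.
Qed.

Lemma oscV k : osc (k^-1)%g = osc k.
Proof.
suff main x : osc x <= osc x^-1%g.
  by apply/le_anti; rewrite main -{2}[k]invgK main.
apply: osc_le => g g'; have := osc_ub x^-1%g (g * x)%g g'.
by rewrite mulgK distrC.
Qed.

Lemma near_osc (e : R) : 0 < e -> \forall k \near 1%g, osc k <= e.
Proof.
move=> e0; have := compact_group_unif_continuous cK cf e0.
by apply: filterS => k kP; apply: osc_le => g g'; exact/ltW.
Qed.

Lemma osc_continuous : continuous osc.
Proof.
move=> k; apply/cvgrPdist_le => e e0.
have := @nbhs_mulgl K k _ (near_osc e0).
apply: filterS => h /= he; rewrite ler_distl; apply/andP; split.
  have := oscM k (k^-1 * h)%g; rewrite mulVKg; lra.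
have := oscM h (h^-1 * k)%g; rewrite mulVKg -(oscV (h^-1 * k)%g) invgM invgK; lra.
Qed.

End oscillation_length.

Section central_bump.
Variables (R : realType) (K : topologicalGroupType).
Hypothesis cK : compact [set: K].

(** The bump is [max 0 (d - r)], where [r] is the sum of the oscillation lengths
    of the [e i]: it is central because these are, and it is nonzero only where
    translations move the [e i] by at most [d]. *)
Lemma exists_central_bump m (e : 'I_m -> K -> R) (d : R) :
  (forall i, continuous (e i)) -> 0 < d ->
  exists u : K -> R, [/\ continuous u, forall k, 0 <= u k, 0 < u 1%g,
    forall k h, u (k * h)%g = u (h * k)%g &
    forall k, u k != 0 -> forall i g, `|e i (g * k)%g - e i g| <= d].
Proof.
move=> ce d0; pose r k := \sum_i osc (e i) k.
have cr : continuous r by apply: continuous_sum => i; exact: osc_continuous.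
exists (fun k => Num.max 0 (d - r k)); split.
- move=> k; apply: (@continuous_max R K (fun=> 0) (fun k => d - r k) k); first exact: cvg_cst.
  by apply: cvgB; [exact: cvg_cst|exact: cr].
- by move=> k; rewrite le_max lexx.
- by rewrite /r big1 ?subr0 ?lt_max ?d0 ?orbT// => i _; rewrite osc1.
- move=> k h; congr (Num.max 0 (d - _)); apply: eq_bigr => i _.
  exact: oscC.
- move=> k uk i g; have rd : r k <= d.
    rewrite leNgt; apply: contra uk => dr; apply/eqP/max_idPl.
    by rewrite subr_le0 ltW.
  have := osc_ub cK (ce i) k g 1%g; rewrite !mulg1 => /le_trans; apply.
  apply: le_trans rd; rewrite /r (bigD1 i)//= lerDl; apply: sumr_ge0 => j _.
  exact: osc_ge0.
Qed.

End central_bump.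

(** * Convolution by a central function *)

Section convolution.
Variables (R : realType) (K : topologicalGroupType).
Hypothesis cK : compact [set: K].
Implicit Types (u f : K -> R).

Definition convolve u f : K -> R := fun g => mean (fun k => u k * f (g * k)%g).

Lemma mean_sum (I : Type) (r : seq I) (F : I -> K -> R) :
  (forall i, continuous (F i)) ->
  mean (fun x => \sum_(i <- r) F i x) = \sum_(i <- r) mean (F i).
Proof.
move=> cF; elim: r => [|i r IH].
  by under eq_fun do rewrite big_nil; rewrite big_nil mean_cst.
under eq_fun do rewrite big_cons.
by rewrite big_cons meanD// ?IH//; exact: continuous_sum.
Qed.

Lemma continuousM_shift u f g : continuous u -> continuous f ->
  continuous (fun k => u k * f (g * k)%g).
Proof.
move=> cu cf k; apply: cvgM; first exact: cu.
by apply: continuous_comp; [exact: mulgl_continuous|exact: cf].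
Qed.

Lemma convolve_sum u (I : Type) (r : seq I) (c : I -> R) (F : I -> K -> R) g :
  continuous u -> (forall i, continuous (F i)) ->
  convolve u (fun x => \sum_(i <- r) c i * F i x) g =
  \sum_(i <- r) c i * convolve u (F i) g.
Proof.
move=> cu cF.
have -> : convolve u (fun x => \sum_(i <- r) c i * F i x) g =
    mean (fun k => \sum_(i <- r) c i * (u k * F i (g * k)%g)).
  congr mean; apply/funext => k; rewrite mulr_sumr.
  by apply: eq_bigr => i _; rewrite mulrCA.
rewrite mean_sum => [|i x]; last by apply: cvgMr; exact: continuousM_shift.
by apply: eq_bigr => i _; rewrite meanZ//; exact: continuousM_shift.
Qed.

(** Convolution by a central function commutes with right translations: this is
    the change of variable [k -> h^-1 * k * h] in the mean. *)
Lemma convolve_shift u f h : continuous u -> continuous f ->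
  (forall x y, u (x * y)%g = u (y * x)%g) ->
  convolve u (fun x => f (x * h)%g) = fun g => convolve u f (g * h)%g.
Proof.
move=> cu cf uC; apply/funext => g; rewrite /convolve.
have cw : continuous (fun k => u k * f (g * h * k)%g).
  exact: continuousM_shift.
have cw' : continuous (fun k => u (h^-1 * k)%g * f (g * h * (h^-1 * k))%g).
  by move=> k; apply: (@continuous_comp _ _ _ (fun k => h^-1 * k)%g
    (fun k => u k * f (g * h * k)%g)); [exact: mulgl_continuous|exact: cw].
rewrite -(mean_mull cK h^-1%g cw) -(mean_mulr cK h cw').
congr mean; apply/funext => k.
by rewrite uC !mulgA !mulgK.
Qed.

Lemma convolve_kernel u f g : continuous u -> continuous f ->
  convolve u f g = mean (fun k => u (g^-1 * k)%g * f k).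
Proof.
move=> cu cf; rewrite /convolve -(mean_mull cK g^-1%g) ?mulVKg//.
  by congr mean; apply/funext => k; rewrite mulVKg.
exact: continuousM_shift.
Qed.

(** Convolution smooths: the modulus of continuity of the result depends on [f]
    through its sup norm alone. *)
Lemma convolve_lipschitz u f g g' b B : continuous u -> continuous f ->
  (forall k, `|u (g^-1 * k)%g - u (g'^-1 * k)%g| <= b) ->
  (forall k, `|f k| <= B) ->
  `|convolve u f g - convolve u f g'| <= b * B.
Proof.
move=> cu cf ub fB; rewrite !convolve_kernel//.
have cuf x : continuous (fun k => u (x^-1 * k)%g * f k).
  move=> k; apply: cvgM; last exact: cf.
  by apply: continuous_comp; [exact: mulgl_continuous|exact: cu].
have cNuf x : continuous (fun k => -1 * (u (x^-1 * k)%g * f k)).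
  by move=> k; apply: cvgMr; exact: cuf.
rewrite -mulN1r -meanZ// -meanD// -[leRHS](mean_cst cK).
apply: mean_norm_le => // [x||x].
- by apply: cvgD; [exact: cuf|exact: cNuf].
- exact: cst_continuous.
- by rewrite mulN1r -mulrBl normrM; apply: ler_pM.
Qed.

Lemma convolve_continuous u f : continuous u -> continuous f ->
  continuous (convolve u f).
Proof.
move=> cu cf g; apply/cvgrPdist_le => e e0.
have [M M0 fM] := compact_group_bounded cK cf.
have b0 : 0 < e / (M + 1) by rewrite divr_gt0// ltr_wpDl.
have uU := compact_group_unif_continuous cK cu b0.
apply: filterS (near_mulVg g uU) => h hw; rewrite distrC.
apply: le_trans (convolve_lipschitz (b := e / (M + 1)) cu cf _ fM) _ => [k|].
  by have := hw 1%g (g^-1 * k)%g; rewrite mul1g mulgA mulgK mul1g => /ltW.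
suff : e / (M + 1) * M <= e / (M + 1) * (M + 1).
  by rewrite (divfK _ e) ?gt_eqF ?ltr_wpDl.
by apply: ler_wpM2l; [exact: ltW|rewrite lerDl].
Qed.

Lemma convolve_bound u f B : continuous u -> continuous f ->
  (forall k, 0 <= u k) -> (forall k, `|f k| <= B) ->
  forall g, `|convolve u f g| <= mean u * B.
Proof.
move=> cu cf u0 fB g; rewrite mulrC -meanZ//.
apply: mean_norm_le => // [|x|k].
- exact: continuousM_shift.
- by apply: cvgMr; exact: cu.
- by rewrite normrM (ger0_norm (u0 k)) mulrC; apply: ler_wpM2r.
Qed.

(** When [u] is nonzero only where translations move [f] by at most [d],
    convolution by [u] is close to multiplication by [mean u]. *)
Lemma convolve_near u f (d : R) : continuous u -> continuous f ->
  (forall k, 0 <= u k) ->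
  (forall k, u k != 0 -> forall g, `|f (g * k)%g - f g| <= d) ->
  forall g, `|convolve u f g - mean u * f g| <= mean u * d.
Proof.
move=> cu cf u0 fd g; rewrite mulrC (mulrC _ d) -mulNr -!meanZ//.
have cZ a : continuous (fun k => a * u k) by move=> x; apply: cvgMr; exact: cu.
rewrite -meanD//; last exact: continuousM_shift.
apply: mean_norm_le => // [x|k].
  by apply: cvgD; [exact: continuousM_shift|exact: cZ].
have -> : u k * f (g * k)%g + - f g * u k = (f (g * k)%g - f g) * u k by ring.
rewrite normrM (ger0_norm (u0 k)).
have [->|uk] := eqVneq (u k) 0; first by rewrite !mulr0.
by apply: ler_wpM2r => //; exact: fd.
Qed.

Lemma iter_convolve_continuous u f k : continuous u -> continuous f ->
  continuous (iter k (convolve u) f).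
Proof. by move=> cu cf; elim: k => [//|k IH]; exact: convolve_continuous. Qed.

Lemma iter_convolve_bound u f k B : continuous u -> continuous f ->
  (forall x, 0 <= u x) -> (forall x, `|f x| <= B) ->
  forall x, `|iter k (convolve u) f x| <= mean u ^+ k * B.
Proof.
move=> cu cf u0 fB; elim: k => [|k IH] x; first by rewrite mul1r.
rewrite exprS -mulrA; apply: convolve_bound => //.
exact: iter_convolve_continuous.
Qed.

Lemma iter_convolve_shift u (l : nat) (f : 'I_l -> K -> R) (a : 'I_l -> K) k :
  continuous u -> (forall i, continuous (f i)) ->
  (forall x y, u (x * y)%g = u (y * x)%g) ->
  iter k (convolve u) (fun x => \sum_i f i (x * a i)%g) =
  fun x => \sum_i iter k (convolve u) (f i) (x * a i)%g.
Proof.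
move=> cu cf uC; elim: k => [//|k IH]; apply/funext => x; rewrite /= IH.
have cs i : continuous (fun x => iter k (convolve u) (f i) (x * a i)%g).
  by apply: continuous_translr; exact: iter_convolve_continuous.
have -> : (fun x => \sum_i iter k (convolve u) (f i) (x * a i)%g) =
    fun x => \sum_i 1 * iter k (convolve u) (f i) (x * a i)%g.
  by apply/funext => y; under [RHS]eq_bigr do rewrite mul1r.
rewrite convolve_sum//; apply: eq_bigr => i _; rewrite mul1r convolve_shift//.
exact: iter_convolve_continuous.
Qed.

End convolution.

(** * Finite-dimensional spaces stable under central convolutions *)

Lemma horner_mx_sum (R : comNzRingType) m (A : 'M[R]_m.+1) (q : {poly R}) :
  horner_mx A q = \sum_(k < size q) q`_k *: A ^+ k.
Proof.
rewrite -{1}[q]coefK poly_def rmorph_sum /=; apply: eq_bigr => k _.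
by rewrite horner_mxZ rmorphXn /= horner_mx_X.
Qed.

Section stable_space.
Variables (R : realType) (K : topologicalGroupType).
Hypothesis cK : compact [set: K].
Variables (E : set (K -> R)) (n : nat) (p : 'I_n -> K).
Hypothesis E_continuous : forall f, E f -> continuous f.
Hypothesis E0 : E (fun=> 0).
Hypothesis E_comb : forall a f h, E f -> E h -> E (fun x => a * f x + h x).
Hypothesis E_inj :
  forall f, E f -> (forall i, f (p i) = 0) -> forall g, f g = 0.

Lemma E_sum m (c : 'I_m -> R) (e : 'I_m -> K -> R) : (forall i, E (e i)) ->
  E (fun x => \sum_(i < m) c i * e i x).
Proof.
move=> Ee; elim: m c e Ee => [|m IH] c e Ee.
  by under eq_fun do rewrite big_ord0.
under eq_fun do rewrite big_ord_recl.
by apply: E_comb => //; exact: IH.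
Qed.

(** Evaluation at the points [p i] embeds [E] into row vectors.  Coordinates in a
    basis are computed from these finitely many values, which is why they are
    bounded by a multiple [C] of the sup norm. *)
Lemma exists_bounded_basis : exists m (e : 'I_m -> K -> R) (C : R),
  [/\ forall i, E (e i), 0 <= C,
    forall c : 'I_m -> R, (forall g, \sum_i c i * e i g = 0) ->
      forall i, c i = 0 &
    forall f, E f -> exists c : 'I_m -> R,
      (forall g, f g = \sum_i c i * e i g) /\
      forall B, (forall g, `|f g| <= B) -> forall i, `|c i| <= C * B].
Proof.
pose w (f : K -> R) : 'rV[R]_n := \row_j f (p j).
have [m [e [Ee rf sp]]] := exists_row_free_spanning E w.
set M := (\matrix_(i < m) w (e i)) in rf sp.
pose C := \sum_i \sum_j `|pinvmx M i j|.
have wsum (c : 'I_m -> R) : w (fun g => \sum_i c i * e i g) = \row_i c i *m M.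
  apply/rowP => j; rewrite !mxE; apply: eq_bigr => i _.
  by rewrite !mxE.
exists m, e, C; split=> //.
- by rewrite /C sumr_ge0// => i _; rewrite sumr_ge0.
- move=> c c0 i; have /eqP : \row_i c i *m M = 0.
    by rewrite -wsum; apply/rowP => j; rewrite !mxE c0.
  by rewrite mulmx_free_eq0// => /eqP/rowP/(_ i); rewrite !mxE.
- move=> f Ef; pose c := w f *m pinvmx M; exists (c 0); split.
    move=> g; apply/eqP; rewrite -subr_eq0; apply/eqP.
    rewrite addrC; have -> : - (\sum_i c 0 i * e i g) + f g =
        -1 * (\sum_i c 0 i * e i g) + f g by rewrite mulN1r.
    apply: (E_inj (f := fun x => -1 * (\sum_i c 0 i * e i x) + f x)).
      by apply: E_comb => //; exact: E_sum.
    move=> j; have /rowP/(_ j) := wsum (c 0).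
    have -> : \row_i c 0 i = c by apply/rowP => i; rewrite mxE.
    by rewrite mulmxKpV ?sp// !mxE => ->; rewrite mulN1r addNr.
  move=> B fB i; rewrite mxE; apply: le_trans (ler_norm_sum _ _ _) _.
  rewrite /C mulr_suml; apply: ler_sum => j _.
  rewrite mxE normrM mulrC; apply: ler_pM => //.
  by rewrite (bigD1 i)//= lerDl sumr_ge0.
Qed.

Hypothesis E_convolve : forall u : K -> R, continuous u ->
  (forall x y, u (x * y)%g = u (y * x)%g) -> forall f, E f -> E (convolve u f).

(** If the basis moves by at most [d] where [u] is nonzero, a function [f] in [E]
    bounded by [B] moves by at most [B / 2], since its coordinates are bounded by
    [C * B].  So [convolve u f = 0] forces [f] to be bounded by [B / 2]. *)
Lemma convolve_inj_of_small_osc m (e : 'I_m -> K -> R) (C d : R) (u : K -> R) :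
  (forall f, E f -> exists c : 'I_m -> R,
      (forall g, f g = \sum_i c i * e i g) /\
      forall B, (forall g, `|f g| <= B) -> forall i, `|c i| <= C * B) ->
  0 <= C -> 0 <= d -> m%:R * C * d <= 1 / 2 ->
  continuous u -> (forall k, 0 <= u k) -> 0 < u 1%g ->
  (forall k, u k != 0 -> forall i g, `|e i (g * k)%g - e i g| <= d) ->
  forall f, E f -> (forall g, convolve u f g = 0) -> forall g, f g = 0.
Proof.
move=> esp C0 d0 mCd cu u0 u1 eu f Ef Tf.
have cf := E_continuous Ef; have [M _ fM] := compact_group_bounded cK cf.
apply: (halving_eq0 fM) => B fB g.
have [c [fE /(_ B fB) cB]] := esp f Ef.
have mu0 := mean_gt0 cK cu u0 u1.
have B0 : 0 <= B by exact: le_trans (normr_ge0 _) (fB g).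
have := convolve_near cK cu cf u0 (d := B / 2) _ g.
rewrite Tf sub0r normrN normrM gtr0_norm// ler_pM2l//; apply.
move=> k uk x; rewrite !fE -sumrB; apply: le_trans (ler_norm_sum _ _ _) _.
apply: (@le_trans _ _ (\sum_(i < m) C * B * d)).
  apply: ler_sum => i _; rewrite -mulrBr normrM; apply: ler_pM => //.
  exact: eu.
rewrite sumr_const card_ord -[_ *+ m]mulr_natl.
by have := ler_wpM2r B0 mCd; lra.
Qed.

Lemma convolve_matrix_unit m (e : 'I_m -> K -> R) (u : K -> R) (A : 'M[R]_m) :
  (forall i, E (e i)) -> continuous u ->
  (forall c : 'I_m -> R, (forall g, \sum_i c i * e i g = 0) ->
      forall i, c i = 0) ->
  (forall f, E f -> (forall g, convolve u f g = 0) -> forall g, f g = 0) ->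
  (forall i g, convolve u (e i) g = \sum_j A i j * e j g) ->
  \det A != 0.
Proof.
move=> Ee cu free inj TA; rewrite -unitfE -[_ \is a _]/(A \in unitmx).
rewrite -row_free_unit; apply: inj_row_free => v vA.
apply/rowP => i; rewrite mxE; apply: (free (v 0)) => g {i}.
apply: (inj (fun x => \sum_i v 0 i * e i x)) => [|{}g]; first exact: E_sum.
rewrite convolve_sum// => [|i]; last exact/E_continuous.
under eq_bigr do rewrite TA mulr_sumr.
rewrite exchange_big big1// => j _.
under eq_bigr do rewrite mulrA.
rewrite -mulr_suml; have /rowP/(_ j) := vA; rewrite !mxE => ->.
by rewrite mul0r.
Qed.

(** The theorem of Cayley and Hamilton for the matrix of [convolve u] on [E], read
    on functions. *)
Lemma convolve_char_poly m (e : 'I_m.+1 -> K -> R) (u : K -> R)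
    (A : 'M[R]_m.+1) :
  (forall i, E (e i)) -> continuous u ->
  (forall f, E f -> exists c : 'I_m.+1 -> R,
    forall g, f g = \sum_i c i * e i g) ->
  (forall i g, convolve u (e i) g = \sum_j A i j * e j g) ->
  forall f, E f -> forall g,
    \sum_(k < size (char_poly A)) (char_poly A)`_k * iter k (convolve u) f g = 0.
Proof.
move=> Ee cu esp TA f Ef g; have [c fE] := esp f Ef.
have ce i : continuous (e i) by exact/E_continuous.
have iterE k : iter k (convolve u) f =
    fun g => \sum_j (\sum_i c i * (A ^+ k) i j) * e j g.
  elim: k => [|k IH].
    apply/funext => x; rewrite /= fE; apply: eq_bigr => j _; congr (_ * _).
    rewrite expr0 (bigD1 j)//= mxE eqxx mulr1 big1 ?addr0// => i ij.
    by rewrite mxE (negbTE ij) mulr0.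
  apply/funext => x; rewrite /= IH convolve_sum//.
  under [LHS]eq_bigr do rewrite TA mulr_sumr.
  rewrite exchange_big; apply: eq_bigr => j _ /=.
  under [LHS]eq_bigr do rewrite mulrA mulr_suml.
  rewrite -mulr_suml; congr (_ * _); rewrite exchange_big /=.
  apply: eq_bigr => i _; rewrite exprSr mxE mulr_sumr.
  by apply: eq_bigr => l _; rewrite mulrA.
under eq_bigr do rewrite iterE mulr_sumr.
rewrite exchange_big big1// => j _ /=.
under eq_bigr do rewrite mulrA mulr_sumr.
rewrite -mulr_suml exchange_big /= big1 ?mul0r// => i _.
have /matrixP/(_ i j) := Cayley_Hamilton A.
rewrite horner_mx_sum summxE [RHS]mxE => CH.
under eq_bigr do rewrite mulrCA.
rewrite -mulr_sumr; transitivity (c i * 0); last exact: mulr0.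
congr (_ * _); rewrite -[RHS]CH; apply: eq_bigr => k _.
by rewrite !mxE.
Qed.

(** The space spanned by the right translates of the functions in [E] is
    finite-dimensional, in the form that its elements are determined by their
    values at finitely many points [q j].  The relation [p(T) = 0] passes from
    [E] to this space, and expresses each of its elements as a convolution of
    a function that it controls. *)
Lemma translates_determined : exists N (q : 'I_N -> K),
  forall l (f : 'I_l -> K -> R) (a : 'I_l -> K), (forall i, E (f i)) ->
    (forall j, \sum_i f i (q j * a i)%g = 0) ->
    forall g, \sum_i f i (g * a i)%g = 0.
Proof.
have [[|m] [e [C [Ee C0 free esp]]]] := exists_bounded_basis.
  exists 0%N, (fun=> 1%g) => l f a Ef _ g; rewrite big1// => i _.
  by have [c [-> _]] := esp _ (Ef i); rewrite big_ord0.
(* This [d] makes [convolve u] injective on [E]. *)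
pose d : R := (2 * (m.+1%:R * C + 1))^-1.
have mC0 : 0 <= m.+1%:R * C by rewrite mulr_ge0.
have d0 : 0 < d by rewrite invr_gt0; lra.
have mCd : m.+1%:R * C * d <= 1 / 2.
  rewrite /d ler_pdivrMr; lra.
have [u [cu u0 u1 uC ue]] := exists_central_bump cK (fun i => E_continuous (Ee i)) d0.
have inj := convolve_inj_of_small_osc esp C0 (ltW d0) mCd cu u0 u1 ue.
have /choice[c cE] : forall i, exists c : 'I_m.+1 -> R,
    forall g, convolve u (e i) g = \sum_j c j * e j g.
  by move=> i; have [c [cE _]] := esp _ (E_convolve cu uC (Ee i)); exists c.
pose A : 'M[R]_m.+1 := \matrix_(i, j) c i j.
have TA i g : convolve u (e i) g = \sum_j A i j * e j g.
  by rewrite cE; apply: eq_bigr => j _; rewrite mxE.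
have dA := convolve_matrix_unit Ee cu free inj TA.
have CH : forall f, E f -> forall g,
    \sum_(k < size (char_poly A)) (char_poly A)`_k * iter k (convolve u) f g = 0.
  apply: (convolve_char_poly Ee cu) => // f Ef.
  by have [b [bE _]] := esp _ Ef; exists b.
set P := char_poly A in CH.
have P0 : `|P`_0| > 0.
  by rewrite normr_gt0 char_poly_det mulf_neq0// signr_eq0.
have sP : size P = (size P).-1.+1.
  by rewrite size_char_poly.
(* If [F] below is bounded by [B], then [chi] is bounded by [D * B], and
   [P`_0 * F = - convolve u chi]; the bound [b] on the modulus of [u] is chosen
   so that [b * D] is at most half of [`|P`_0|]. *)
pose D := \sum_(k < (size P).-1) `|P`_k.+1| * mean u ^+ k.
have mu0 : 0 <= mean u by exact/ltW/(mean_gt0 cK cu u0 u1).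
have D0 : 0 <= D by apply: sumr_ge0 => k _; rewrite mulr_ge0// exprn_ge0.
pose b := `|P`_0| / (2 * (D + 1)).
have b0 : 0 < b by rewrite divr_gt0//; lra.
have bD : b * D <= `|P`_0| / 2.
  have -> : `|P`_0| / 2 = b * (D + 1).
    by rewrite /b; field; rewrite gt_eqF//; lra.
  by apply: ler_wpM2l; [exact: ltW|rewrite lerDl].
have uU := compact_group_unif_continuous cK cu b0.
have [z _ cov] := compact_group_net cK (near_invg uU).
exists (size z), (fun j => nth 1%g z j) => l f a Ef fz.
have cf i : continuous (f i) by exact/E_continuous/Ef.
pose F := fun x => \sum_i f i (x * a i)%g.
have cF : continuous F.
  by apply: continuous_sum => i; exact: continuous_translr.
have [M _ FM] := compact_group_bounded cK cF.
pose chi := fun x => \sum_(k < (size P).-1) P`_k.+1 * iter k (convolve u) F x.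
have cchi : continuous chi.
  by apply: continuous_sum => k x; apply: cvgMr; exact: iter_convolve_continuous.
have Fchi g : P`_0 * F g = - convolve u chi g.
  apply/eqP; rewrite -addr_eq0; apply/eqP.
  transitivity (\sum_(k < size P) P`_k * iter k (convolve u) F g).
    rewrite [in RHS]sP big_ord_recl; congr (_ + _).
    by rewrite convolve_sum// => k; exact: iter_convolve_continuous.
  under eq_bigr do rewrite iter_convolve_shift// mulr_sumr.
  by rewrite exchange_big big1// => i _; exact: CH.
apply: (halving_eq0 FM) => B FB g.
have B0 : 0 <= B by exact: le_trans (normr_ge0 _) (FB g).
have chiB x : `|chi x| <= D * B.
  apply: le_trans (ler_norm_sum _ _ _) _; rewrite /D mulr_suml.
  apply: ler_sum => k _; rewrite normrM -mulrA; apply: ler_wpM2l => //.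
  exact: iter_convolve_bound.
have [y yz gy] := cov g.
have Fy : F y = 0.
  by have := fz (Ordinal (eq_ind_r is_true yz (index_mem y z))); rewrite /= nth_index.
have ub k : `|u (g^-1 * k)%g - u (y^-1 * k)%g| <= b.
  have := gy y^-1%g k; rewrite invgM invgK mulgA mulVg mul1g.
  exact: ltW.
have := convolve_lipschitz cK cu cchi ub chiB.
have -> : convolve u chi y = 0.
  by apply/eqP; rewrite -oppr_eq0 -Fchi Fy mulr0.
rewrite subr0 -[X in X <= _]normrN -Fchi normrM => h.
rewrite -(ler_pM2l P0); apply: le_trans h _.
by rewrite mulrA; have := ler_wpM2r B0 bD; lra.
Qed.

End stable_space.

(** * A subgroup that acts transitively on the quotient *)

Section transitive_subgroup.
Variables (R : realType) (K : topologicalGroupType).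
Hypothesis cK : compact [set: K].
Variables (S L O : set K) (phi : K -> R) (d : nat) (v : 'I_d -> K).
Hypothesis c_phi : continuous phi.
Hypothesis S_phi : forall s g, S s -> phi (s * g)%g = phi g.
Hypothesis SL : forall g, exists s l, [/\ S s, L l & g = (s * l)%g].
Hypothesis cL : compact L.
Hypothesis L_div : forall l l', L l -> L l' -> L (l^-1 * l')%g.
Hypothesis O1 : nbhs 1%g O.
Hypothesis v_phi : forall w, L w -> O w -> exists c : 'I_d -> R,
  forall g, phi (g * w)%g = \sum_i c i * phi (g * v i)%g.

(** The candidate for a finite-dimensional space containing [phi] and stable
    under central convolutions.  It is defined by the relations that [phi]
    satisfies, because a relation between right translates is inherited by every
    operator that commutes with them, whereas the translates of [phi]
    themselves need not be mapped into their span. *)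
Definition dominated : set (K -> R) := [set f |
  [/\ continuous f, forall s g, S s -> f (s * g)%g = f g &
  forall w, L w -> O w -> forall c : 'I_d -> R,
    (forall g, phi (g * w)%g = \sum_i c i * phi (g * v i)%g) ->
    forall g, f (g * w)%g = \sum_i c i * f (g * v i)%g]].

Lemma dominated0 : dominated (fun=> 0).
Proof.
split=> // [|w _ _ c _ g]; first exact: cst_continuous.
by rewrite big1// => i _; rewrite mulr0.
Qed.

Lemma dominated_comb a f h : dominated f -> dominated h ->
  dominated (fun x => a * f x + h x).
Proof.
move=> [cf Sf vf] [ch Sh vh]; split=> [x|s g Ss|w Lw Ow c cE g].
- by apply: cvgD; [apply: cvgMr; exact: cf|exact: ch].
- by rewrite Sf// Sh.
- rewrite (vf w Lw Ow c cE) (vh w Lw Ow c cE) mulr_sumr -big_split.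
  by apply: eq_bigr => i _ /=; ring.
Qed.

Lemma dominated_convolve (u : K -> R) : continuous u ->
  (forall x y, u (x * y)%g = u (y * x)%g) ->
  forall f, dominated f -> dominated (convolve u f).
Proof.
move=> cu uC f [cf Sf vf]; split=> [|s g Ss|w Lw Ow c cE g].
- exact: convolve_continuous.
- by rewrite /convolve /=; congr mean; apply/funext => k; rewrite -mulgA (Sf s).
- have -> : convolve u f (g * w)%g = convolve u (fun x => f (x * w)%g) g.
    by rewrite convolve_shift.
  have -> : (fun x => f (x * w)%g) = fun x => \sum_i c i * f (x * v i)%g.
    by apply/funext => x; exact: vf.
  rewrite convolve_sum// => [|i]; last exact: continuous_translr.
  by apply: eq_bigr => i _; rewrite convolve_shift.
Qed.

(** Finitely many left translates, by elements [x] of [L], of the part of [L] in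
    [O] cover [L]; on such a translate the values of a dominated [f] are
    combinations of the values at the points [x * v i], and [S]-invariance
    carries this from [L] to the whole group. *)
Lemma dominated_determined : exists n (p : 'I_n -> K), forall f, dominated f ->
  (forall i, f (p i) = 0) -> forall g, f g = 0.
Proof.
have [z [zL cov]] := compact_finite_net cL (fun x _ => @nbhs_mulgl K x _ O1).
pose s := [seq (x * v i)%g | x <- z, i <- enum 'I_d].
exists (size s), (fun i => nth 1%g s i) => f [_ Sf vf] f0 g.
have [t [l [St Ll ->]]] := SL g; rewrite Sf// {t St}.
have [x xz Oxl] := cov l Ll.
have [c cE] := v_phi (L_div (zL x xz) Ll) Oxl.
rewrite -(mulVKg x l) (vf _ (L_div (zL x xz) Ll) Oxl c cE) big1// => i _.
have xs : (x * v i)%g \in s.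
  by apply/allpairsP; exists (x, i); rewrite mem_enum.
have := f0 (Ordinal (eq_ind_r is_true xs (index_mem _ s))).
by rewrite /= nth_index// => ->; rewrite mulr0.
Qed.

Lemma dominated_self : dominated phi.
Proof. by split. Qed.

Lemma transitive_subgroup_translates_determined : exists N (q : 'I_N -> K),
  forall l (c : 'I_l -> R) (a : 'I_l -> K),
    (forall j, \sum_i c i * phi (q j * a i)%g = 0) ->
    forall g, \sum_i c i * phi (g * a i)%g = 0.
Proof.
have [n [p pE]] := dominated_determined.
have dom_continuous f : dominated f -> continuous f by case.
have [N [q qE]] := translates_determined (E := dominated) cK dom_continuous
  dominated0 dominated_comb pE dominated_convolve.
exists N, q => l c a; apply: (qE l (fun i x => c i * phi x)) => i.
have -> : (fun x => c i * phi x) = fun x => c i * phi x + 0.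
  by apply/funext => x; rewrite addr0.
exact: dominated_comb dominated_self dominated0.
Qed.

End transitive_subgroup.

(** * Subgroups and local actions *)

Section subgroup_topology.
Variables (G : topologicalGroupType) (H : subgroup G).

Lemma subgroup_valP (h : subgroup_type H) : subgroup_set H (subgroup_val h).
Proof. exact: set_valP. Qed.

Lemma subgroup_val_surj g : subgroup_set H g -> exists h : subgroup_type H, subgroup_val h = g.
Proof. by move=> Hg; exists (exist _ g (mem_set Hg)). Qed.

Lemma subgroup_mem1 : subgroup_set H 1%g.
Proof. by have [/set_mem] := subgroup_closed H. Qed.

Lemma subgroup_memV g : subgroup_set H g -> subgroup_set H g^-1%g.
Proof.
move=> Hg; have := group_closedV (subgroup_closed H) (mem_set Hg).
exact: set_mem.
Qed.

Lemma subgroup_memM g h :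
  subgroup_set H g -> subgroup_set H h -> subgroup_set H (g * h)%g.
Proof.
move=> Hg Hh.
have := group_closedM (subgroup_closed H) (mem_set Hg) (mem_set Hh).
exact: set_mem.
Qed.

Lemma subgroup_memMr g h :
  subgroup_set H h -> subgroup_set H (g * h)%g -> subgroup_set H g.
Proof.
by move=> Hh Hgh; rewrite -(mulgK h g); apply: subgroup_memM => //; exact: subgroup_memV.
Qed.

Lemma nbhs_subgroupP (h : subgroup_type H) (U : set (subgroup_type H)) :
  nbhs h U <-> exists2 A, nbhs (subgroup_val h) A &
    forall k, A (subgroup_val k) -> U k.
Proof.
split.
  case=> B [[A oA <-] Ah] AU; exists A; last exact: AU.
  by apply: open_nbhs_nbhs; split.
by move=> [A Ah AU]; apply: filterS AU _; exact: subgroup_val_continuous.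
Qed.

Lemma compact_subgroup_preimage (A : set G) : A `<=` H -> compact A ->
  compact [set h : subgroup_type H | A (subgroup_val h)].
Proof.
move=> AH /compact_near_coveringP cA; apply/compact_near_coveringP.
move=> I F P FF FP.
have : \near F, A `<=` (fun g => forall k : subgroup_type H,
    subgroup_val k = g -> P F k).
  apply: cA => g Ag; have [h hg] := subgroup_val_surj (AH g Ag).
  rewrite -hg in Ag *; have [[U W] [/nbhs_subgroupP[B Bh BU] FW] UWP] := FP h Ag.
  exists (B, W) => // -[b i] [/= Bb Wi] k kb.
  by apply: (UWP (k, i)); split=> //=; apply: BU; rewrite kb.
apply: filterS => i iP h Ah; exact: (iP _ Ah).
Qed.

Lemma compact_subgroup : compact H -> compact [set: subgroup_type H].
Proof.
move=> cH; have := compact_subgroup_preimage (@subset_refl _ H) cH.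
have -> // : [set h : subgroup_type H | subgroup_set H (subgroup_val h)] = setT.
by apply/seteqP; split=> // h _; exact: subgroup_valP.
Qed.

End subgroup_topology.

Section action_topology.
Variables (G : topologicalGroupType) (X : topologicalType).
Variable a : local_right_action G X.

Lemma act_cvg x g : dom a (x, g) ->
  (fun xp : X * G => act a xp.1 xp.2) @ (x, g) --> act a x g.
Proof.
move=> xg; have := act_continuous a.
rewrite continuous_open_subspace; last exact: dom_open.
by move=> /(_ (x, g) (mem_set xg)).
Qed.

Lemma nbhs_dom x g : dom a (x, g) -> nbhs (x, g) (dom a).
Proof. by move=> xg; apply: open_nbhs_nbhs; split=> //; exact: dom_open. Qed.

Lemma nbhs_dom_l x g : dom a (x, g) -> \forall h \near g, dom a (x, h).
Proof.
move=> /nbhs_dom xg; have : (fun h : G => (x, h)) @ g --> (x, g).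
  by apply: cvg_pair; [exact: cvg_cst|exact: cvg_id].
by move=> /(_ _ xg).
Qed.

Lemma nbhs_dom_r x g : dom a (x, g) -> \forall y \near x, dom a (y, g).
Proof.
move=> /nbhs_dom xg; have : (fun y : X => (y, g)) @ x --> (x, g).
  by apply: cvg_pair; [exact: cvg_id|exact: cvg_cst].
by move=> /(_ _ xg).
Qed.

Lemma act_cvg_l x g : dom a (x, g) -> act a x @ g --> act a x g.
Proof.
move=> xg; have xh : (fun h : G => (x, h)) @ g --> (x, g).
  by apply: cvg_pair; [exact: cvg_cst|exact: cvg_id].
exact: cvg_comp xh (act_cvg xg).
Qed.

Lemma act_cvg_r x g : dom a (x, g) -> (fun y => act a y g) @ x --> act a x g.
Proof.
move=> xg; have yg : (fun y : X => (y, g)) @ x --> (x, g).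
  by apply: cvg_pair; [exact: cvg_id|exact: cvg_cst].
exact: cvg_comp yg (act_cvg xg).
Qed.

Lemma dom_actV x g : dom a (x, g) -> dom a (act a x g, g^-1)%g.
Proof. by move=> xg; apply/(domM _ xg); rewrite mulgV; exact: dom1. Qed.

Lemma actV x g : dom a (x, g) -> act a (act a x g) g^-1%g = x.
Proof.
move=> xg; rewrite -actM ?mulgV ?act1//.
exact: dom1.
Qed.

(** The tube lemma for the action. *)
Lemma near_act_compact (S O : set X) : compact S -> open O -> S `<=` O ->
  \forall u \near 1%g, forall y, S y -> dom a (y, u) /\ O (act a y u).
Proof.
move=> cS oO SO.
suff: \forall u \near 1%g, S `<=` (fun y => dom a (y, u) /\ O (act a y u)) by [].
apply: (iffLR (compact_near_coveringP _) cS) => y Sy.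
have yO : \forall xp \near (y, 1%g : G), dom a xp /\ O (act a xp.1 xp.2).
  apply: filterI; first exact/nbhs_dom/dom1.
  have := act_cvg (dom1 a y); apply.
  by rewrite act1; apply: open_nbhs_nbhs; split=> //; exact: SO.
by apply: filterS yO => -[].
Qed.

Lemma near_dom_compact (S : set X) : compact S ->
  \forall u \near 1%g, forall y, S y -> dom a (y, u).
Proof.
move=> cS; have := near_act_compact cS openT (@subsetT _ S).
by apply: filterS => u Su y /Su[].
Qed.

Definition stabilizer x : set G := [set g | dom a (x, g) /\ act a x g = x].

Lemma stabilizer_mull x s g : stabilizer x s ->
  (dom a (x, s * g)%g <-> dom a (x, g)) /\
  (dom a (x, g) -> act a x (s * g)%g = act a x g).
Proof.
move=> [xs sx]; split; first by rewrite domM// sx.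
by move=> xg; rewrite actM ?sx// domM// sx.
Qed.

(** The domain is open, but membership of a limit [g] of stabilizing elements
    [h] in the domain still holds: [h^-1 * g] is near [1], hence it can be applied
    to [x = x.h]. *)
Lemma closed_stabilizer x : hausdorff_space X -> closed (stabilizer x).
Proof.
move=> hX g clg.
have xg : dom a (x, g).
  have := near_mulVg g (nbhs_dom_l (dom1 a x)).
  move=> /clg[h [hx /= dh]].
  by have [xhg _] := stabilizer_mull (h^-1 * g)%g hx; rewrite mulVKg in xhg; exact/xhg.
split=> //; apply/eqP/negPn/negP => gx.
move: hX; rewrite open_hausdorff => /(_ _ _ gx)[[A B] /= [gA xB] [oA oB /eqP AB]].
have /clg[h [[_ hx] /= Ah]] : nbhs g [set h | A (act a x h)].
  apply: act_cvg_l => //; apply: open_nbhs_nbhs; split=> //.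
  exact: set_mem.
have : (A `&` B) x by split; [rewrite -hx|exact: set_mem].
by rewrite AB.
Qed.

End action_topology.

Lemma homeomorphism_on_open_image (S T : topologicalType) (A B : set S)
    (f : S -> T) : homeomorphism_on A f -> open (f @` A) -> open B ->
  B `<=` A -> open (f @` B).
Proof.
move=> [g [_ cg gK]] ofA oB BA; rewrite openE => _ [x Bx <-].
move: cg; rewrite continuous_open_subspace// => /(_ (f x)).
have Ax := BA _ Bx.
have fAx : f x \in f @` A by apply/mem_set; exists x.
move=> /(_ fAx) gfx; have gx : g @ f x --> g (f x) := gfx.
rewrite gK// in gx; rewrite /interior.
have nB : nbhs (f x) (g @^-1` B) := gx B (open_nbhs_nbhs (conj oB Bx)).
apply: filterS (filterI nB (open_nbhs_nbhs (conj ofA (set_mem fAx)))).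
by move=> y [/= Bgy [z Az zy]]; exists z => //; rewrite -zy gK// in Bgy.
Qed.

Lemma open_subgroup_closed (G : topologicalGroupType) (K : subgroup G) :
  open K -> closed K.
Proof.
move=> oK g clg.
have [h [Kh Kgh]] : (subgroup_set K `&` [set h | subgroup_set K (g^-1 * h)%g]) !=set0.
  apply: clg; apply: nbhs_mulgl; apply: open_nbhs_nbhs; split=> //.
  exact: subgroup_mem1.
by rewrite -[g]invgK; apply/subgroup_memV/(subgroup_memMr Kh).
Qed.

(** * Factorization through the stabilizer of a point *)

Lemma exists_subgroup_of_set (G : groupType) (A : set G) : A 1%g ->
  (forall g h, A g -> A h -> A (g * h^-1)%g) ->
  exists K : subgroup G, subgroup_set K = A.
Proof.
move=> A1 AV; have gA : group_closed (mem A).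
  split; first exact/mem_set.
  by move=> g h /set_mem Ag /set_mem Ah; exact/mem_set/AV.
by exists (Subgroup gA).
Qed.

(** By the tube lemma, [Y] being compact and open, every [u] near [1] satisfies
    [Y * u] inside [Y] and [Y * u^-1] inside [Y], that is, [Y * u = Y]. *)
Lemma compact_open_right_stabilizer (G : topologicalGroupType)
    (K : subgroup G) (Y : set G) : open K -> compact Y -> open Y ->
  exists K' : subgroup G,
    [/\ open K', K' `<=` K & forall k, subgroup_set K' k <->
      subgroup_set K k /\ forall y, Y (y * k)%g <-> Y y].
Proof.
move=> oK cY oY.
have [||K' K'E] := @exists_subgroup_of_set G
  [set k | subgroup_set K k /\ forall y, Y (y * k)%g <-> Y y].
- by split=> [|y]; [exact: subgroup_mem1|rewrite mulg1].
- move=> g h [Kg gY] [Kh hY]; split.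
    by apply: subgroup_memM => //; exact: subgroup_memV.
  by move=> y; rewrite -hY -mulgA mulgVK gY.
exists K'; rewrite K'E; split=> // [|k []//].
have nK : nbhs 1%g (subgroup_set K).
  by apply: open_nbhs_nbhs; split=> //; exact: subgroup_mem1.
have nY : \forall u \near 1%g, Y `<=` (fun y => Y (y * u)%g).
  apply: (iffLR (compact_near_coveringP _) cY) => y Yy.
  have : (fun t : G * G => t.1 * t.2)%g @ (y, 1%g) --> (y * 1)%g.
    exact: (@mulg_continuous G (y, 1%g)).
  by rewrite mulg1 => /(_ Y (open_nbhs_nbhs (conj oY Yy))).
have nYV := near_invg nY.
rewrite openE => k [Kk kY].
have n1 : \forall u \near 1%g, subgroup_set K u /\
    (Y `<=` (fun y => Y (y * u)%g) /\ Y `<=` (fun y => Y (y * u^-1)%g)).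
  by apply: filterI nK _; exact: filterI nY nYV.
apply: filterS (@nbhs_mulgl G k _ n1) => h /= [Kkh [Yu YuV]]; rewrite -(mulVKg k h); split.
  exact: subgroup_memM.
move=> y; rewrite mulgA -(kY y); split=> [/YuV|/Yu//].
by rewrite mulgK.
Qed.

(** A homeomorphism onto an open set maps the smaller neighborhoods of [1] to open
    sets, so the elements of [H] that lie in [K] suffice to reach every point
    near [x]. *)
Lemma local_orbit (G : topologicalGroupType)
    (X : topologicalType) (a : local_right_action G X) (H K : subgroup G) x :
  locally_homeomorphic (restrict_action a H) -> open K ->
  \forall y \near x, exists h, [/\ subgroup_set H h, subgroup_set K h,
    dom a (x, h) & y = act a x h].
Proof.
move=> lh oK; have [V [[oV V1] Vdom oxV homV]] := lh x.
pose B := V `&` (@subgroup_val G H) @^-1` K.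
have oB : open B.
  apply: openI => //.
  by move/continuousP : (@subgroup_val_continuous G H); apply.
have oxB := homeomorphism_on_open_image homV oxV oB (@subIsetl _ _ _).
have Bx : nbhs x (act (restrict_action a H) x @` B).
  apply: open_nbhs_nbhs; split=> //; exists 1%g; last exact: act1.
  by split=> //=; rewrite subgroup_val1; exact: subgroup_mem1.
apply: filterS Bx => _ [h [Vh Kh] <-]; exists (subgroup_val h); split=> //.
- exact: subgroup_valP.
- exact: Vdom.
Qed.

(** For [g] near [1] the point [x.g] is near [x], so it is [x.h] for some [h] in
    [H] and [K]; then [g * h^-1] stabilizes [x]. *)
Lemma near_identity_factorization (G : topologicalGroupType)
    (X : topologicalType) (a : local_right_action G X) (H K : subgroup G) x :
  locally_homeomorphic (restrict_action a H) -> open K ->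
  \forall g \near 1%g, subgroup_set K g /\ exists s h,
    [/\ stabilizer a x s, subgroup_set K s, subgroup_set H h, subgroup_set K h
      & g = (s * h)%g].
Proof.
move=> lh oK.
have near_xg : \forall g \near 1%g, exists h, [/\ subgroup_set H h,
    subgroup_set K h, dom a (x, h) & act a x g = act a x h].
  have := act_cvg_l (dom1 a x).
  by rewrite act1 => /(_ _ (local_orbit x lh oK)).
have nK : nbhs 1%g (subgroup_set K).
  by apply: open_nbhs_nbhs; split=> //; exact: subgroup_mem1.
apply: filterS (filterI nK (filterI near_xg (nbhs_dom_l (dom1 a x)))).
move=> g [Kg [[h [Hh Kh xh xgh]] xg]]; split=> //.
exists (g * h^-1)%g, h; split=> //; last by rewrite mulgVK.
  have d : dom a (x, g * h^-1)%g.
    by apply/(domM _ xg); rewrite xgh; exact: dom_actV.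
  by split=> //; rewrite actM// xgh actV.
by apply: subgroup_memM => //; exact: subgroup_memV.
Qed.

(** The set [Y = S * L] contains a neighborhood of [1] and is stable under [S] on
    the left and under [L] on the right, so it is open; it is compact as a product
    of compact sets.  Its right stabilizer [K'] is contained in [Y] and contains
    [L], whence the factorization takes place inside [K']. *)
Lemma exists_transitive_subgroup (G : topologicalGroupType)
    (X : topologicalType) (a : local_right_action G X) (H K : subgroup G) x :
  hausdorff_space X -> closed H ->
  locally_homeomorphic (restrict_action a H) -> open K -> compact K ->
  exists K' : subgroup G, [/\ open K', compact K' &
    forall k, subgroup_set K' k -> exists s h, [/\ stabilizer a x s,
      subgroup_set H h, subgroup_set K' s, subgroup_set K' h & k = (s * h)%g]].
Proof.
move=> hX cH lh oK cK.
pose S := stabilizer a x `&` subgroup_set K.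
pose L := subgroup_set H `&` subgroup_set K.
have kc := open_subgroup_closed oK.
have cS : compact S.
  apply: subclosed_compact cK (@subIsetr _ _ _).
  by apply: closedI => //; exact: closed_stabilizer.
have cL : compact L.
  by apply: subclosed_compact cK (@subIsetr _ _ _); exact: closedI.
pose Y := (fun t : G * G => t.1 * t.2)%g @` (S `*` L).
have cY : compact Y.
  apply: continuous_compact; last exact: compact_setX.
  exact/continuous_subspaceT/mulg_continuous.
pose N : set G := fun g => subgroup_set K g /\ exists s h,
    [/\ stabilizer a x s, subgroup_set K s, subgroup_set H h, subgroup_set K h
      & g = (s * h)%g].
have nY : nbhs 1%g N by exact: near_identity_factorization.
have SM s s' : S s -> S s' -> S (s * s')%g.
  move=> [sx Ks] [[s'd s'x] Ks']; split; last exact: subgroup_memM.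
  have [d e] := stabilizer_mull s' sx; split; first exact/d.
  by rewrite e.
have LM l l' : L l -> L l' -> L (l * l')%g.
  by move=> [Hl Kl] [Hl' Kl']; split; exact: subgroup_memM.
have LV l : L l -> L l^-1%g by move=> [Hl Kl]; split; exact: subgroup_memV.
have oY : open Y.
  rewrite openE => _ [[s l] [/= Ss Ll] <-].
  have nsl : \forall g \near (s * l)%g, N (s^-1 * g * l^-1)%g.
    have : (fun g : G => s^-1 * g * l^-1)%g @ (s * l)%g -->
        (s^-1 * (s * l) * l^-1)%g.
      by do 2 (apply: cvg_mulg; try exact: cvg_cst); exact: cvg_id.
    by rewrite mulKg mulgV => /(_ _ nY).
  apply: filterS nsl => g [_ [s' [l' [s'x Ks' Hl' Kl' e]]]].
  exists (s * s', l' * l)%g; first by split; [exact: SM|exact: LM].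
  by rewrite /= mulgA -(mulgA s) -e !mulgA mulgV mul1g mulgVK.
have [K' [oK' K'K K'E]] := compact_open_right_stabilizer oK cY oY.
have S1 : S 1%g.
  by split; [split; [exact: dom1|exact: act1]|exact: subgroup_mem1].
have L1 : L 1%g by split; exact: subgroup_mem1.
have LK' l : L l -> subgroup_set K' l.
  move=> Ll; apply/K'E; split; first by case: Ll.
  move=> y; split.
    move=> [[s l'] [/= Ss Ll'] e]; exists (s, l' * l^-1)%g.
      by split=> //; apply: LM => //; exact: LV.
    by rewrite /= mulgA e mulgK.
  move=> [[s l'] [/= Ss Ll'] <-]; exists (s, l' * l)%g; last by rewrite /= mulgA.
  by split=> //; exact: LM.
exists K'; split=> //.
  apply: subclosed_compact cK K'K; exact: open_subgroup_closed.
move=> k K'k; have [_ kY] := iffLR (K'E k) K'k.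
have /kY : Y 1%g by exists (1%g, 1%g) => //=; rewrite mulg1.
rewrite mul1g => -[[s l] [/= [sx Ks] Ll] e].
exists s, l; split=> //; first by case: Ll.
- by apply: (subgroup_memMr (LK' _ Ll)); rewrite e.
- exact: LK'.
Qed.

Section orbit_functions.
Variables (R : realType) (G : topologicalGroupType) (X : topologicalType).
Variables (a : local_right_action G X) (r : X -> R).

Definition rtranslate (g : G) (y : X) : R :=
  if `[< dom a (y, g) >] then r (act a y g) else 0.

Lemma rtranslateE g y : dom a (y, g) -> rtranslate g y = r (act a y g).
Proof. by move=> yg; rewrite /rtranslate asboolT. Qed.

Lemma rtranslate0 g y : ~ dom a (y, g) -> rtranslate g y = 0.
Proof. by move=> yg; rewrite /rtranslate asboolF. Qed.

Variable S : set X.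
Hypothesis rS : forall y, r y != 0 -> S y.

Lemma rtranslate_neq0 g y : rtranslate g y != 0 -> dom a (y, g) /\ S (act a y g).
Proof.
rewrite /rtranslate; case: asboolP => [yg|_]; last by rewrite eqxx.
by move=> /rS.
Qed.

(** The only obstruction to this identity is a point [x.(g * w)] in the support
    of [r] with [x.g] undefined; but [w^-1] can be applied to it. *)
Lemma rtranslateM g w x : (forall y, S y -> dom a (y, w^-1)%g) ->
  rtranslate (g * w)%g x =
  if `[< dom a (x, g) >] then rtranslate w (act a x g) else 0.
Proof.
move=> Sw; case: asboolP => [xg|nxg].
  have [xgw|nxgw] := pselect (dom a (x, g * w)%g).
    by rewrite !rtranslateE ?actM// -domM.
  by rewrite !rtranslate0// -domM.
apply/eqP/negPn/negP => /rtranslate_neq0[xgw /Sw].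
by rewrite -domM// mulgK.
Qed.

Lemma rtranslate_stabilizer s g x : stabilizer a x s ->
  rtranslate (s * g)%g x = rtranslate g x.
Proof.
move=> /(stabilizer_mull g)[d e]; have [xg|nxg] := pselect (dom a (x, g)).
  by rewrite !rtranslateE ?e//; exact/d.
by rewrite !rtranslate0// d.
Qed.

Hypothesis cr : continuous r.
Hypothesis cS : compact S.

(** The extension by zero is continuous: if [x.g] is undefined, so is [x.h] in
    the support of [r] for [h] near [g], because [h^-1 * g] is near [1] and can be
    applied to every point of the compact set [S]. *)
Lemma continuous_orbit_function x : continuous (fun g => rtranslate g x).
Proof.
move=> g; have [xg|nxg] := pselect (dom a (x, g)).
  rewrite /continuous_at rtranslateE//.
  have : (fun h => r (act a x h)) @ g --> r (act a x g).
    by apply: continuous_cvg; [exact: cr|exact: act_cvg_l].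
  apply: cvg_trans; apply: near_eq_cvg.
  by apply: filterS (nbhs_dom_l xg) => h xh; rewrite rtranslateE.
rewrite /continuous_at rtranslate0//.
have : (fun _ : G => 0 : R) @ g --> (0 : R) by exact: cvg_cst.
apply: cvg_trans; apply: near_eq_cvg.
apply: filterS (near_mulVg g (near_dom_compact a cS)) => h hS; apply/eqP; rewrite eq_sym.
apply/negPn/negP => /rtranslate_neq0[xh /hS].
by rewrite -domM// mulVKg.
Qed.

End orbit_functions.

(** * Translates near the identity are determined by finitely many values *)

Section translates.
Variables (R : realType) (G : topologicalGroupType) (X : topologicalType).
Variables (a : local_right_action G X) (H : subgroup G).
Hypothesis cH : closed H.
Variables (r : X -> R) (S : set X).
Hypothesis rS : forall y, r y != 0 -> S y.
Hypothesis cr : continuous r.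
Hypothesis cS : compact S.
Variables (O : set G) (n : nat) (b : 'I_n -> X -> R).
Hypothesis O1 : nbhs 1%g O.
Hypothesis OS : forall h, subgroup_set H h -> O h ->
  forall y, S y -> dom a (y, h^-1)%g.
Hypothesis Ob : forall h, subgroup_set H h -> O h -> exists c : 'I_n -> R,
  forall y, rtranslate a r h y = \sum_i c i * b i y.

(** The finiteness theorem for compact groups, applied to the function that sends
    [k] to [r (x.k)] on the group [K].  The finitely many translates [v i] of
    [r] by elements of both [H] and [K] that span all the others are obtained by
    comparing coordinates with respect to [b]. *)
Lemma orbit_translates_determined (K : subgroup G) x : compact K ->
  (forall k, subgroup_set K k -> exists s h, [/\ stabilizer a x s,
      subgroup_set H h, subgroup_set K s, subgroup_set K h & k = (s * h)%g]) ->
  exists N (q : 'I_N -> G), forall l (c : 'I_l -> R) (g : 'I_l -> G),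
    (forall i, subgroup_set K (g i)) ->
    (forall j, \sum_i c i * rtranslate a r (q j * g i)%g x = 0) ->
    forall k, subgroup_set K k -> \sum_i c i * rtranslate a r (k * g i)%g x = 0.
Proof.
move=> cK KSH; have cK' := compact_subgroup cK.
pose L := [set k : subgroup_type K | subgroup_set H (subgroup_val k)].
pose P := L `&` [set k : subgroup_type K | O (subgroup_val k)].
have /choice[w wE] : forall h, exists c : 'I_n -> R, subgroup_set H h -> O h ->
    forall y, rtranslate a r h y = \sum_i c i * b i y.
  move=> h; have [[Hh Oh]|nP] := pselect (subgroup_set H h /\ O h).
    by have [c cE] := Ob Hh Oh; exists c.
  by exists (fun=> 0) => Hh Oh; case: nP.
have [d [v [Pv _ Pspan]]] := exists_row_free_spanning P
  (fun k : subgroup_type K => \row_i w (subgroup_val k) i).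
have trv (k : subgroup_type K) : P k -> exists c : 'I_d -> R, forall y,
    rtranslate a r (subgroup_val k) y =
    \sum_i c i * rtranslate a r (subgroup_val (v i)) y.
  move=> Pk; have [c /rowP cE] := submx_sum_rows (Pspan k Pk).
  exists c => y; rewrite wE; [|by case: Pk|by case: Pk].
  under [RHS]eq_bigr => i _.
    rewrite wE; [|by case: (Pv i)|by case: (Pv i)].
    rewrite mulr_sumr; over.
  rewrite exchange_big; apply: eq_bigr => j _ /=.
  have := cE j; rewrite mxE => ->; rewrite summxE mulr_suml.
  by apply: eq_bigr => i _; rewrite !mxE mulrA.
pose phi (k : subgroup_type K) := rtranslate a r (subgroup_val k) x.
have cphi : continuous phi.
  move=> k; apply: (@continuous_comp _ _ _ (@subgroup_val G K)
    (fun g => rtranslate a r g x)); first exact: subgroup_val_continuous.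
  exact: continuous_orbit_function rS cr cS x _.
have cL : compact L.
  have cHK : compact (subgroup_set H `&` subgroup_set K).
    by rewrite setIC; exact: compact_closedI.
  have -> : L = [set k : subgroup_type K |
      (subgroup_set H `&` subgroup_set K) (subgroup_val k)].
    by apply/seteqP; split=> k /= => [Lk|[]//]; split=> //; exact: subgroup_valP.
  exact: compact_subgroup_preimage (@subIsetr _ _ _) cHK.
have OP : nbhs 1%g [set k : subgroup_type K | O (subgroup_val k)].
  by apply/nbhs_subgroupP; exists O => //; rewrite subgroup_val1.
have [|k||k kL|N [q qE]] := @transitive_subgroup_translates_determined R (subgroup_type K) cK'
  [set s | stabilizer a x (subgroup_val s)] L
  [set k | O (subgroup_val k)] phi d v cphi _ _ cL _ OP _.
- by move=> s g sx; rewrite /phi subgroup_valM rtranslate_stabilizer.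
- have [s [h [sx Hh Ks Kh e]]] := KSH _ (subgroup_valP k).
  have [s' s's] := subgroup_val_surj Ks; have [h' h'h] := subgroup_val_surj Kh.
  exists s', h'; split; rewrite /= ?s's ?/L/= ?h'h//.
  by apply/val_inj; rewrite -/(subgroup_val _) -/(subgroup_val k) e -s's -h'h -subgroup_valM.
- move=> l l' Ll Ll'; rewrite /L/= subgroup_valM; apply: subgroup_memM => //.
  exact: subgroup_memV.
- move=> Ok; have [c cE] := trv k (conj kL Ok); exists c => g.
  rewrite /phi subgroup_valM (rtranslateM rS); last exact: OS.
  under eq_bigr => i _.
    rewrite subgroup_valM (rtranslateM rS); last by apply: OS; case: (Pv i).
    over.
  case: asboolP => _; first exact: cE.
  by rewrite big1// => i _; rewrite mulr0.
exists N, (fun j => subgroup_val (q j)) => l c g Kg h0 k Kk.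
have /choice[g' g'E] : forall i, exists g' : subgroup_type K, subgroup_val g' = g i.
  by move=> i; exact: subgroup_val_surj (Kg i).
have [k' k'E] := subgroup_val_surj Kk; rewrite -k'E.
have := qE l c g' _ k'; rewrite /phi.
under eq_bigr do rewrite subgroup_valM g'E.
apply=> j; rewrite -[RHS](h0 j); apply: eq_bigr => i _.
by rewrite subgroup_valM g'E.
Qed.

Hypothesis hX : hausdorff_space X.
Hypothesis lh : locally_homeomorphic (restrict_action a H).

(** Finitely many local orbits [U z] cover [S].  If the translate of [r] by [g i]
    is nonzero at [y], then [y] is [(y.(g i)).(g i)^-1], a point near [S], so [y]
    is [z.h] for one of the centers [z], and the values of all the translates at
    [y] are values of the orbit function at [z]. *)
Lemma translates_determined_near_identity (K0 : subgroup G) :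
  open K0 -> compact K0 ->
  exists (Q : seq X) (W : set G), nbhs 1%g W /\
    forall l (c : 'I_l -> R) (g : 'I_l -> G), (forall i, W (g i)) ->
      (forall y, y \in Q -> \sum_i c i * rtranslate a r (g i) y = 0) ->
      forall y, \sum_i c i * rtranslate a r (g i) y = 0.
Proof.
move=> oK0 cK0.
have /choice[K KP] x := exists_transitive_subgroup x hX cH lh oK0 cK0.
have /choice[q qP] : forall x, exists q : seq G,
    forall l (c : 'I_l -> R) (g : 'I_l -> G),
    (forall i, subgroup_set (K x) (g i)) ->
    (forall p, p \in q -> \sum_i c i * rtranslate a r (p * g i)%g x = 0) ->
    forall k, subgroup_set (K x) k ->
      \sum_i c i * rtranslate a r (k * g i)%g x = 0.
  move=> x; have [_ cKx Kx] := KP x.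
  have [N [q qE]] := orbit_translates_determined cKx Kx.
  exists [seq q j | j <- enum 'I_N] => l c g Kg h0; apply: qE => // j.
  by apply: h0; apply: map_f; rewrite mem_enum.
pose U x : set X := [set y | exists h, [/\ subgroup_set H h,
  subgroup_set (K x) h, dom a (x, h) & y = act a x h]].
have nU x : nbhs x (U x)^°.
  by apply: nbhs_interior; apply: local_orbit => //; have [] := KP x.
have [s [_ scov]] := compact_finite_net cS (fun x _ => nU x).
pose V := \bigcup_(z in [set` s]) (U z)^°.
have oV : open V by apply: bigcup_open => z _; exact: open_interior.
have SV : S `<=` V by move=> y /scov[z zs Uzy]; exists z.
have Wn := near_act_compact a cS oV SV.
have WVn := near_invg Wn.
have Kn : \forall u \near 1%g, forall z, z \in s -> subgroup_set (K z) u.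
  elim: s {scov V oV SV Wn WVn} => [|z s IH]; first exact: nearW.
  have nK : nbhs 1%g (subgroup_set (K z)).
    by apply: open_nbhs_nbhs; split; [have [] := KP z|exact: subgroup_mem1].
  apply: filterS2 nK IH => u Ku us y; rewrite inE => /orP[/eqP->//|].
  exact: us.
pose Q := [seq act a z p | z <- s, p <- q z].
exists Q, (fun u => (forall y, S y ->
    dom a (y, u^-1)%g /\ V (act a y u^-1)%g) /\
    forall z, z \in s -> subgroup_set (K z) u).
split; first exact: filterI.
move=> l c g Wg gQ y.
have gM i z p : rtranslate a r (p * g i)%g z =
    if `[< dom a (z, p) >] then rtranslate a r (g i) (act a z p) else 0.
  apply: (rtranslateM rS) => t St.
  by have [/(_ t St)[]] := Wg i.
have [all0|/existsNP[i /eqP yi]] :=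
    pselect (forall i, rtranslate a r (g i) y = 0).
  by rewrite big1// => i _; rewrite all0 mulr0.
have [yg Syg] := rtranslate_neq0 rS yi.
have [/(_ _ Syg)[_]] := Wg i; rewrite actV// => -[z zs].
move=> /interior_subset[h [_ Kh zh ->]] _.
have := qP z l c g _ _ h Kh.
under eq_bigr do rewrite gM asboolT//.
apply=> [j|p pq]; first by have [_] := Wg j; apply.
under eq_bigr do rewrite gM.
case: asboolP => zp; last by rewrite big1// => j _; rewrite mulr0.
by apply: gQ; apply/allpairsPdep; exists z, p.
Qed.

End translates.

(** * Complex functions with compact support *)

Section complex_parts.
Variable R : realType.

Lemma ReD (x y : R[i]) : complex.Re (x + y) = complex.Re x + complex.Re y.
Proof. by move: x y => [? ?] [? ?]. Qed.

Lemma ImD (x y : R[i]) : complex.Im (x + y) = complex.Im x + complex.Im y.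
Proof. by move: x y => [? ?] [? ?]. Qed.

Lemma Re_sum (I : Type) (s : seq I) (F : I -> R[i]) :
  complex.Re (\sum_(i <- s) F i) = \sum_(i <- s) complex.Re (F i).
Proof. exact: (big_morph _ ReD). Qed.

Lemma Im_sum (I : Type) (s : seq I) (F : I -> R[i]) :
  complex.Im (\sum_(i <- s) F i) = \sum_(i <- s) complex.Im (F i).
Proof. exact: (big_morph _ ImD). Qed.

Lemma ReM (x y : R[i]) : complex.Re (x * y) =
  complex.Re x * complex.Re y - complex.Im x * complex.Im y.
Proof. by move: x y => [? ?] [? ?]. Qed.

Lemma ImM (x y : R[i]) : complex.Im (x * y) =
  complex.Re x * complex.Im y + complex.Im x * complex.Re y.
Proof. by move: x y => [? ?] [? ?]. Qed.

Lemma normc_ge_Im (x : R[i]) : `|complex.Im x|%:C <= `|x|.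
Proof.
rewrite normc_def lecR -sqrtr_sqr; apply: ler_wsqrtr.
by rewrite lerDr sqr_ge0.
Qed.

Lemma continuous_Re (X : topologicalType) (f : X -> R[i]^o) :
  continuous f -> continuous (fun x => complex.Re (f x)).
Proof.
move=> cf x; apply/cvgrPdist_lt => e e0.
have e0' : 0 < e%:C :> R[i] by rewrite ltcR.
have /cvgrPdist_lt/(_ _ e0') := cf x.
apply: filterS => y fxy; rewrite -ltcR.
apply: le_lt_trans fxy; apply: le_trans (normc_ge_Re _).
by case: (f x) => ? ?; case: (f y).
Qed.

Lemma continuous_Im (X : topologicalType) (f : X -> R[i]^o) :
  continuous f -> continuous (fun x => complex.Im (f x)).
Proof.
move=> cf x; apply/cvgrPdist_lt => e e0.
have e0' : 0 < e%:C :> R[i] by rewrite ltcR.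
have /cvgrPdist_lt/(_ _ e0') := cf x.
apply: filterS => y fxy; rewrite -ltcR.
apply: le_lt_trans fxy; apply: le_trans (normc_ge_Im _).
by case: (f x) => ? ?; case: (f y).
Qed.

End complex_parts.

Section compactly_supported.
Variables (R : realType) (X : topologicalType).
Implicit Types f h : X -> R[i]^o.

Lemma Cc0 : Cc (fun _ : X => 0 : R[i]^o).
Proof.
split; first exact: cst_continuous.
rewrite /supp; have -> : [set x : X | (0 : R[i]^o) != 0] = set0.
  by apply/seteqP; split=> x //=; rewrite eqxx.
by rewrite closure0; exact: compact0.
Qed.

Lemma Cc_comb (c : R[i]) f h : Cc f -> Cc h -> Cc (c *: f + h).
Proof.
move=> [cf kf] [ch kh]; split.
  by move=> x; apply: cvgD; [exact: cvgM (cvg_cst _) (cf x)|exact: ch].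
apply: (subclosed_compact _ (compactU kf kh)); first exact: closed_closure.
rewrite /supp -closureU; apply: closure_subset => x /=.
have -> : (c *: f + h) x = c * f x + h x by [].
have [f0|fx] := eqVneq (f x) 0; last by left.
by have [h0|hx] := eqVneq (h x) 0; [rewrite f0 h0 mulr0 addr0 eqxx|right].
Qed.

Lemma Cc_sum m (c : 'I_m -> R[i]) (f : 'I_m -> X -> R[i]^o) :
  (forall i, Cc (f i)) -> Cc (\sum_i c i *: f i).
Proof.
elim: m c f => [|m IH] c f cf; first by rewrite big_ord0; exact: Cc0.
by rewrite big_ord_recl; apply: Cc_comb => //; exact: IH.
Qed.

Variables (G : topologicalGroupType) (a : local_right_action G X).

(** The translate is supported in the compact set [C], the image of the support
    of [f] under [g^-1].  Since [C] lies in the open domain of [g], the domain of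
    [g] and the complement of [C] form an open cover on each piece of which
    continuity is clear. *)
Lemma translate_Cc f (g : G) : hausdorff_space X -> Cc f ->
  (forall y, supp f y -> dom a (y, g^-1)%g) -> Cc (translate a g f).
Proof.
move=> hX [cf kf] fg; pose C := (fun y => act a y g^-1%g) @` supp f.
have kC : compact C.
  apply: continuous_compact kf; apply: continuous_in_subspaceT => y /set_mem fy.
  exact/act_cvg_r/fg.
have clC := compact_closed hX kC.
have Cdom : C `<=` [set x | dom a (x, g)].
  by move=> _ [y fy <-] /=; rewrite -{2}[g]invgK; exact/dom_actV/fg.
have trC x : translate a g f x != 0 -> C x.
  rewrite /translate; case: asboolP => [xg fxg|_]; last by rewrite eqxx.
  by exists (act a x g); [exact: subset_closure|exact: actV].
split; last first.
  apply: (subclosed_compact _ kC); first exact: closed_closure.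
  by rewrite (iffLR (closure_id C) clC); apply: closure_subset => x; exact: trC.
move=> x; have [xg|nxg] := pselect (dom a (x, g)).
  have tx : translate a g f x = f (act a x g) by rewrite /translate asboolT.
  rewrite /continuous_at tx.
  have : (fun y => f (act a y g)) @ x --> f (act a x g).
    by apply: continuous_cvg; [exact: cf|exact: act_cvg_r].
  apply: cvg_trans; apply: near_eq_cvg.
  by apply: filterS (nbhs_dom_r xg) => y yg; rewrite /translate asboolT.
have tx : translate a g f x = 0 by rewrite /translate asboolF.
rewrite /continuous_at tx.
have : (fun _ : X => 0 : R[i]^o) @ x --> (0 : R[i]^o) by exact: cvg_cst.
apply: cvg_trans; apply: near_eq_cvg.
have nC : nbhs x (~` C).
  apply: open_nbhs_nbhs; split; first exact: closed_openC.
  by move=> /Cdom.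
apply: filterS nC => y nCy; apply/eqP; rewrite eq_sym.
by apply/negPn/negP => /trC.
Qed.

End compactly_supported.

Section translate_parts.
Variables (R : realType) (G : topologicalGroupType) (X : topologicalType).
Variables (a : local_right_action G X) (f : X -> R[i]^o).

Lemma Re_translate g y :
  complex.Re (translate a g f y) = rtranslate a (fun x => complex.Re (f x)) g y.
Proof. by rewrite /translate /rtranslate; case: asboolP. Qed.

Lemma Im_translate g y :
  complex.Im (translate a g f y) = rtranslate a (fun x => complex.Im (f x)) g y.
Proof. by rewrite /translate /rtranslate; case: asboolP. Qed.

(** The [n + n] real functions whose real combinations contain the real and the
    imaginary parts of all complex combinations of [b]. *)
Definition re_im_parts n (b : 'I_n -> X -> R[i]^o) (i : 'I_(n + n)) : X -> R :=
  match fintype.split i with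
  | inl j => fun x => complex.Re (b j x)
  | inr j => fun x => complex.Im (b j x)
  end.

Lemma re_im_parts_comb n (b : 'I_n -> X -> R[i]^o) (u v : 'I_n -> R) :
  exists c : 'I_(n + n) -> R, forall y, \sum_i c i * re_im_parts b i y =
    \sum_j (u j * complex.Re (b j y) + v j * complex.Im (b j y)).
Proof.
exists (fun i => match fintype.split i with inl j => u j | inr j => v j end) => y.
rewrite big_split_ord big_split /=; congr (_ + _); apply: eq_bigr => j _.
  by rewrite /re_im_parts (unsplitK (inl j : 'I_n + 'I_n)).
by rewrite /re_im_parts (unsplitK (inr j : 'I_n + 'I_n)).
Qed.

Lemma re_im_parts_span n (b : 'I_n -> X -> R[i]^o) (c : 'I_n -> R[i])
    (h : X -> R[i]^o) : h = \sum_(i < n) c i *: b i ->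
  (exists d : 'I_(n + n) -> R, forall y,
    complex.Re (h y) = \sum_i d i * re_im_parts b i y) /\
  (exists d : 'I_(n + n) -> R, forall y,
    complex.Im (h y) = \sum_i d i * re_im_parts b i y).
Proof.
have sumE y : (\sum_(i < n) c i *: b i) y = \sum_(i < n) c i * b i y.
  by rewrite fct_sumE.
move=> ->; split.
  have [d dE] := re_im_parts_comb b (fun i => complex.Re (c i)) (fun i => - complex.Im (c i)).
  exists d => y; rewrite dE sumE Re_sum; apply: eq_bigr => i _.
  by rewrite ReM mulNr.
have [d dE] := re_im_parts_comb b (fun i => complex.Im (c i)) (fun i => complex.Re (c i)).
exists d => y; rewrite dE sumE Im_sum; apply: eq_bigr => i _.
by rewrite ImM addrC.
Qed.

End translate_parts.

(** The difference of the two sides of the relation is a single combination, with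
    [h] as its first term. *)
Lemma determined_relation (R : realType) (T Y : Type) (E : set T)
    (Q : set Y) (t : T -> Y -> R) :
  (forall l (c : 'I_l -> R) (g : 'I_l -> T), (forall i, E (g i)) ->
    (forall y, Q y -> \sum_i c i * t (g i) y = 0) ->
    forall y, \sum_i c i * t (g i) y = 0) ->
  forall m (c : 'I_m -> R) (g : 'I_m -> T) h, (forall i, E (g i)) -> E h ->
    (forall y, Q y -> t h y = \sum_i c i * t (g i) y) ->
    forall y, t h y = \sum_i c i * t (g i) y.
Proof.
move=> det m c g h Eg Eh hQ y.
pose c' i := oapp (fun j => - c j) 1 (unlift (@ord0 m) i).
pose g' i := oapp g h (unlift (@ord0 m) i).
have sumE z : \sum_i c' i * t (g' i) z = t h z - \sum_i c i * t (g i) z.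
  rewrite big_ord_recl /c' /g' unlift_none /= mul1r; congr (_ + _).
  by rewrite -sumrN; apply: eq_bigr => i _; rewrite liftK /= mulNr.
have Eg' i : E (g' i) by rewrite /g'; case: (unlift _ i).
apply/eqP; rewrite -subr_eq0 -sumE; apply/eqP; apply: det => // z Qz.
by rewrite sumE hQ// subrr.
Qed.

(** * Polynomial functions *)

Theorem proposition6p14 (R : realType)
  (G : topologicalGroupType)
  (G_hausdorff : hausdorff_space G) (G_lc : locally_compact [set: G])
  (G_compact_open : exists K : subgroup G, compact K /\ open K)
  (H : subgroup G) (H_closed : closed H)
  (X : topologicalType)
  (X_hausdorff : hausdorff_space X) (X_lc : locally_compact [set: X])
  (a : local_right_action G X)
  (aH_homeo : locally_homeomorphic (restrict_action a H))
  (f : X -> R[i]^o) (f_Cc : Cc f) :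
  polynomial_for (restrict_action a H) f -> polynomial_for a f.
Proof.
have [cf kf] := f_Cc; have [K0 [cK0 oK0]] := G_compact_open.
move=> [V [F0 [[oV V1] VV _ [n [b [_ bspan]]] Vf]]].
have [U] : exists2 U : set G, nbhs (subgroup_val (1%g : subgroup_type H)) U &
    forall h : subgroup_type H, U (subgroup_val h) -> V h.
  by apply/nbhs_subgroupP; apply: open_nbhs_nbhs.
rewrite subgroup_val1 => U1 UV.
have US h : subgroup_set H h -> U h -> forall y, supp f y -> dom a (y, h^-1)%g.
  move=> /subgroup_val_surj[k <-] /UV/VV Vk y fy.
  by rewrite -subgroup_valV; exact: Vk.
have Ub h : subgroup_set H h -> U h -> exists c : 'I_n -> R[i],
    translate a h f = \sum_i c i *: b i.
  by move=> /subgroup_val_surj[k <-] /UV/Vf; exact: bspan.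
have Re_rel h : subgroup_set H h -> U h -> exists c : 'I_(n + n) -> R,
    forall y, rtranslate a (fun x => complex.Re (f x)) h y =
      \sum_i c i * re_im_parts b i y.
  move=> Hh /(Ub _ Hh)[c /re_im_parts_span[[d dE] _]]; exists d => y.
  by rewrite -dE Re_translate.
have Im_rel h : subgroup_set H h -> U h -> exists c : 'I_(n + n) -> R,
    forall y, rtranslate a (fun x => complex.Im (f x)) h y =
      \sum_i c i * re_im_parts b i y.
  move=> Hh /(Ub _ Hh)[c /re_im_parts_span[_ [d dE]]]; exists d => y.
  by rewrite -dE Im_translate.
have Re_supp y : complex.Re (f y) != 0 -> supp f y.
  by move=> fy; apply: subset_closure; apply: contraNneq fy => /= ->.
have Im_supp y : complex.Im (f y) != 0 -> supp f y.
  by move=> fy; apply: subset_closure; apply: contraNneq fy => /= ->.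
have [Q1 [W1 [W1n /determined_relation Q1det]]] := translates_determined_near_identity
  H_closed Re_supp (continuous_Re cf) kf U1 US Re_rel X_hausdorff aH_homeo oK0 cK0.
have [Q2 [W2 [W2n /determined_relation Q2det]]] := translates_determined_near_identity
  H_closed Im_supp (continuous_Im cf) kf U1 US Im_rel X_hausdorff aH_homeo oK0 cK0.
have VfN : nbhs 1%g (V_ a f).
  exact: near_invg (near_dom_compact a kf).
pose W := (W1 `&` (W2 `&` V_ a f))^°.
have WN : nbhs 1%g W.
  by apply: nbhs_interior; apply: filterI => //; exact: filterI.
have WE g : W g -> [/\ W1 g, W2 g & V_ a f g].
  by move=> /interior_subset[? []].
(* Real coefficients that work for both parts at once are needed, hence the two
   rows of values are put side by side. *)
pose w g := row_mx
  (\row_j rtranslate a (fun x => complex.Re (f x)) g (tnth (in_tuple Q1) j))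
  (\row_j rtranslate a (fun x => complex.Im (f x)) g (tnth (in_tuple Q2) j)).
have [m [t [Wt _ tspan]]] := exists_row_free_spanning W w.
have translate_span g : W g -> exists c : 'I_m -> R[i],
    translate a g f = \sum_j c j *: translate a (t j) f.
  move=> Wg; have [c cE] := submx_sum_rows (tspan g Wg).
  have [W1g W2g _] := WE g Wg.
  have [cE1 cE2] : (forall y, y \in Q1 ->
      rtranslate a (fun x => complex.Re (f x)) g y =
      \sum_j c j * rtranslate a (fun x => complex.Re (f x)) (t j) y) /\
    (forall y, y \in Q2 ->
      rtranslate a (fun x => complex.Im (f x)) g y =
      \sum_j c j * rtranslate a (fun x => complex.Im (f x)) (t j) y).
    split=> y yQ.
      have /tnthP[j ->] : y \in in_tuple Q1 by [].
      have /rowP/(_ (lshift _ j)) := cE; rewrite row_mxEl mxE => ->.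
      by rewrite summxE; apply: eq_bigr => i _; rewrite mxE row_mxEl mxE.
    have /tnthP[j ->] : y \in in_tuple Q2 by [].
    have /rowP/(_ (rshift _ j)) := cE; rewrite row_mxEr mxE => ->.
    by rewrite summxE; apply: eq_bigr => i _; rewrite mxE row_mxEr mxE.
  have Et1 i : W1 (t i) by have [] := WE _ (Wt i).
  have Et2 i : W2 (t i) by have [] := WE _ (Wt i).
  exists (fun j => (c j)%:C); apply/funext => y; rewrite fct_sumE.
  apply/eqP; rewrite eq_complex Re_translate Im_translate Re_sum Im_sum.
  rewrite (Q1det _ c t g Et1 W1g cE1) (Q2det _ c t g Et2 W2g cE2).
  apply/andP; split; apply/eqP; apply: eq_bigr => j _.
    by rewrite ReM Re_translate mul0r subr0.
  by rewrite ImM Im_translate mul0r addr0.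
exists W, [set h | exists c : 'I_m -> R[i], h = \sum_j c j *: translate a (t j) f].
split.
- by split; [exact: open_interior|exact: nbhs_singleton].
- by move=> g /WE[].
- split.
    move=> _ [c ->]; apply: Cc_sum => j; apply: translate_Cc => //.
    by have [] := WE _ (Wt j).
  split.
    apply/mem_set; exists (fun=> 0); rewrite big1// => j _.
    by rewrite scale0r.
  move=> k _ _ /set_mem[c ->] /set_mem[d ->]; apply/mem_set.
  exists (fun j => k * c j + d j); rewrite scaler_sumr -big_split /=.
  by apply: eq_bigr => j _; rewrite scalerDl scalerA.
- exists m, (fun j => translate a (t j) f); split=> // i.
  exists (fun j => (j == i)%:R); rewrite (bigD1 i)//= eqxx scale1r.
  by rewrite big1 ?addr0// => j /negbTE ->; rewrite scale0r.
- exact: translate_span.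
Qed.
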